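(* Let $w=(w_1,\dots,w_n)\in\mathbb Z^n_{\geq1}$ be a primitive vector, let $w_0=\min_i w_i$, $A_w=\{i:w_i=w_0\}$, and let $m_w=\langle x_i:i\in A_w\rangle\subseteq\mathcal O_n$. Let $f:(\mathbb C^n,0)\to(\mathbb C,0)$ be a semi-weighted homogeneous function germ of degree $d$ with respect to $w$, and let $h=p_w(f)$. Suppose that there exists some $i_0\in A_w$ such that $\frac{\partial f}{\partial x_{i_0}}\in m_w$. Then $$\mathscr L_0(\nabla h)=\mathscr L_0(\nabla f)=\frac{d-w_0}{w_0}.$$ In particular, if $A_w=\{i_0\}$ for some $i_0\in\{1,\dots,n\}$, and $k_{i_0}\geq2$ for all $k\in\operatorname{supp}_{i_0}(f)$, then $\mathscr L_0(\nabla h)=\mathscr L_0(\nabla f)=\frac{d-w_0}{w_0}$.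
   Context: $\mathcal O_n$ is the ring of germs at $0$ of holomorphic functions on $\mathbb C^n$. A vector in $\mathbb Z^n_{\geq 1}$ is primitive if its coordinates have greatest common divisor $1$. For $0\ne f=\sum_k a_kx^k\in\mathcal O_n$, $\operatorname{supp}(f)=\{k:a_k\neq0\}$, $d_w(f)=\min\{\langle w,k\rangle:k\in\operatorname{supp}(f)\}$, and the principal part $p_w(f)$ is the sum of all terms $a_kx^k$ with $\langle w,k\rangle=d_w(f)$. The germ $f$ is semi-weighted homogeneous of degree $d$ with respect to $w$ if $d_w(f)=d$ and $p_w(f)$ has an isolated singularity at the origin (i.e. $(\nabla p_w(f))^{-1}(0)=\{0\}$ as germs at $0$). $\operatorname{supp}_{i}(f)$ is the set of $k=(k_1,\dots,k_n)\in\operatorname{supp}(f)$ with $k_{i}\neq0$. For an analytic map germ $g=(g_1,\dots,g_n):(\mathbb C^n,0)\to(\mathbb C^n,0)$ with $g^{-1}(0)=\{0\}$, the Łojasiewicz exponent $\mathscr L_0(g)$ is the infimum of those $\alpha>0$ for which there exist a constant $C>0$ and an open neighbourhood $U$ of $0$ in $\mathbb C^n$ with $\|x\|^\alpha\leq C\sup_i|g_i(x)|$ for all $x\in U$. $\nabla f=(\partial f/\partial x_1,\dots,\partial f/\partial x_n)$. *)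

(* Defs.v *)
From HB Require Import structures.
From mathcomp Require Import all_boot all_order all_algebra finmap complex.
From mathcomp Require Import all_classical all_reals all_analysis.
From mathcomp Require showcase.summability.

Set Implicit Arguments.
Unset Strict Implicit.
Unset Printing Implicit Defensive.
Import Order.TTheory GRing.Theory Num.Theory numFieldNormedType.Exports.

Local Open Scope classical_set_scope.
Local Open Scope ring_scope.

(* The topology and norm of the field R[i], as numFieldNormedType provides them
   for the generic number fields. *)
#[non_forgetful_inheritance]
HB.instance Definition _ (R : realType) := GRing.ComAlgebra.copy R[i] R[i]^o.
#[non_forgetful_inheritance]
HB.instance Definition _ (R : realType) := Vector.copy R[i] R[i]^o.
#[non_forgetful_inheritance]
HB.instance Definition _ (R : realType) := NormedModule.copy R[i] R[i]^o.

Section weights.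
Variable n : nat.
Implicit Types (w : 'I_n -> nat) (k : {ffun 'I_n -> nat}).

Definition primitive_weight w := \big[gcdn/0%N]_(i < n) w i = 1%N.

(* The seed of the iterated minimum is an upper bound of all the w i, hence
   harmless as soon as 0 < n. *)
Definition min_weight w : nat := \big[minn/(\max_(i < n) w i)%N]_(i < n) w i.

Definition min_weight_set w : {set 'I_n} := [set i | w i == min_weight w]%SET.

Definition weight w k : nat := (\sum_(i < n) w i * k i)%N.

End weights.

(* A germ at 0 of a function on C^n is represented by a function defined on
   the whole of C^n, of which only the values near 0 matter; C is R[i]. *)
Section germs.
Variables (R : realType) (n : nat).
Implicit Types (x : 'rV[R[i]]_n) (k : {ffun 'I_n -> nat}) (w : 'I_n -> nat).
Implicit Types (f : 'rV[R[i]]_n -> R[i]) (g : 'rV[R[i]]_n -> 'rV[R[i]]_n).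

Definition monomial k x : R[i] := \prod_(i < n) x 0 i ^+ k i.

(* Near 0, f is the sum of the power series with coefficients a; convergence
   is along the finite sets of exponents, i.e. unconditional, which in C
   amounts to absolute convergence. *)
Definition power_expansion f (a : {ffun 'I_n -> nat} -> R[i]) : Prop :=
  \forall x \near (0 : 'rV[R[i]]_n),
    summability.partial_sum (fun k => a k * monomial k x)
      @ summability.totally --> f x.

Definition holomorphic_germ f : Prop := exists a, power_expansion f a.

Definition taylor_coef f : {ffun 'I_n -> nat} -> R[i] :=
  xget (fun=> 0) [set a | power_expansion f a].

Definition supp f : set {ffun 'I_n -> nat} := [set k | taylor_coef f k != 0].

Definition supp_at (i : 'I_n) f : set {ffun 'I_n -> nat} :=
  [set k | supp f k /\ k i <> 0%N].

(* Meaningful when supp f is nonempty. *)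
Definition weighted_order w f : nat :=
  xget 0%N [set d | (exists2 k, supp f k & weight w k = d) /\
                    (forall k, supp f k -> (d <= weight w k)%N)].

(* The index set is finite when all the weights are positive. *)
Definition principal_part w f : 'rV[R[i]]_n -> R[i] := fun x =>
  \sum_(k \in [set k | supp f k /\ weight w k = weighted_order w f])
    taylor_coef f k * monomial k x.

Definition partial (i : 'I_n) f : 'rV[R[i]]_n -> R[i] :=
  fun x => 'D_(delta_mx 0 i) f x.

Definition gradient f : 'rV[R[i]]_n -> 'rV[R[i]]_n :=
  fun x => \row_(i < n) partial i f x.

Definition isolated_singularity f : Prop :=
  \forall x \near (0 : 'rV[R[i]]_n), gradient f x = 0 <-> x = 0.

Definition semi_weighted_homogeneous w (d : nat) f : Prop :=
  [/\ supp f !=set0, weighted_order w f = d &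
      isolated_singularity (principal_part w f)].

Definition coordinate_ideal (A : {set 'I_n}) f : Prop :=
  exists2 q : 'I_n -> 'rV[R[i]]_n -> R[i],
    (forall i, i \in A -> holomorphic_germ (q i)) &
    \forall x \near (0 : 'rV[R[i]]_n), f x = \sum_(i in A) x 0 i * q i x.

Definition euclidean_norm x : R :=
  Num.sqrt (\sum_(i < n) Normc.normc (x 0 i) ^+ 2).

Definition sup_norm x : R := \big[Num.max/0]_(i < n) Normc.normc (x 0 i).

(* The infimum is taken in the extended reals, so that it is +oo when no
   exponent is admissible. *)
Definition lojasiewicz_exponent g : \bar R :=
  ereal_inf [set alpha%:E | alpha in [set alpha : R | 0 < alpha /\
    exists2 c : R, 0 < c &
      \forall x \near (0 : 'rV[R[i]]_n),
        euclidean_norm x `^ alpha <= c * sup_norm (g x)]].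

End germs.

(* Main.v *)
(** With [s] the quasi-norm [max_i |x_i|^(1/w_i)] and [x = s.y], homogeneity and
compactness of the unit sphere give [max_i |d_i f(x)| / s^(d - w_i) >= c > 0],
since [d_i f(s.y) = s^(d - w_i) d_i h(y) + O(s^(d + 1 - w_i))]; as
[|x| <= C s^w0], the exponent is at most [(d - w0) / w0].

For the converse, the [n - 1] germs [d_i f], [i <> i0], have common zeros on every
small sphere.  At such a zero [d_i h(y)] is small for [i <> i0], so
[|d_i0 h(y)| >= c]; as [d_i0 h] vanishes where the coordinates in [A_w] do, some
[y_l] with [l] in [A_w] is bounded below.  Hence [|x| >= c' s^w0] while the
gradient is [O(s^(d - w0))].

The common zeros come from a maximum principle rather than from dimension
theory: for [n - 1] analytic [g_i], [|x|^2 - M sum_i |g_i|^2] has no interior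
maximum, because some complex direction is killed by all the [dg_i].

All this applies to [h] as well, since [h] is its own principal part. *)

Require Import Defs.
From HB Require Import structures.
From mathcomp Require Import all_boot all_order all_algebra finmap complex.
From mathcomp Require Import all_classical all_reals all_analysis.
From mathcomp Require Import ring lra zify.

Set Implicit Arguments.
Unset Strict Implicit.
Unset Printing Implicit Defensive.
Import Order.TTheory GRing.Theory Num.Theory numFieldNormedType.Exports.

Local Open Scope classical_set_scope.
Local Open Scope ring_scope.

Import Normc.

(** * Complex norm and polydiscs *)

(** The maximum principle is proved with four points because two are not enough. Along a complex
    line whose direction is killed by the differentials, each [g_i] still moves by [O(t^2)];
    multiplied by [g_i(x0)], this changes [|g_i|^2] at the very order at which [|x|^2] grows.
    Averaging over the steps [t], [it], [-t], [-it] cancels the degrees 1 to 3 of [g_i], so the mean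
    of [|g_i|^2] changes by [O(t^4)] only, against a gain of exactly [t^2 |xi|^2].

    All the analysis takes place on complex lines. A truncated power series restricted to a line is
    a polynomial in [t], and a bound on the weighted sum of its coefficients, uniform in the
    truncation, plays the part of Cauchy's estimates: continuity, partial derivatives and four-point
    means come from its Taylor remainders of order 1, 2 and 4.

    The hypothesis on [i0] concerns [f], while the argument uses a property of [h]; it is
    transferred by letting the scale [s] tend to 0 at a fixed [y]. *)

Section complex_norm.
Variable R : realType.
Implicit Types z u v : R[i].

Lemma normc_ge0 z : 0 <= normc z.
Proof. by case: z => a b; exact: sqrtr_ge0. Qed.

Lemma normr_normc z : `|z| = (normc z)%:C%C.
Proof. by []. Qed.

Lemma normc_real (r : R) : normc r%:C%C = `|r|.
Proof. by rewrite /= expr0n /= addr0 sqrtr_sqr. Qed.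

Lemma normc_distC u v : normc (u - v) = normc (v - u).
Proof. by rewrite -normcN opprB. Qed.

Lemma normcX z m : normc (z ^+ m) = normc z ^+ m.
Proof. by elim: m => [|m IH]; rewrite ?expr0 ?normc1 // !exprS normcM IH. Qed.

Lemma normc_prod (I : Type) (r : seq I) (P : pred I) (F : I -> R[i]) :
  normc (\prod_(i <- r | P i) F i) = \prod_(i <- r | P i) normc (F i).
Proof. by apply: (big_morph _ (@normcM R) (@normc1 R)). Qed.

Lemma le_normc_sum (I : Type) (r : seq I) (P : pred I) (F : I -> R[i]) :
  normc (\sum_(i <- r | P i) F i) <= \sum_(i <- r | P i) normc (F i).
Proof.
elim/big_ind2 : _ => [|u1 r1 u2 r2 h1 h2|//]; first by rewrite normc0.
exact: le_trans (le_normcD _ _) (lerD h1 h2).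
Qed.

Lemma le_normcB u v : normc u - normc v <= normc (u - v).
Proof. by rewrite lerBlDr -{1}(subrK v u) le_normcD. Qed.

Lemma normc_eq0 z : (normc z == 0) = (z == 0).
Proof.
by apply/eqP/eqP => [/eq0_normc|->] //; rewrite normc0.
Qed.

Lemma normc_gt0 z : (0 < normc z) = (z != 0).
Proof. by rewrite lt_neqAle normc_ge0 andbT eq_sym normc_eq0. Qed.

Lemma normc_nat m : normc (m%:R : R[i]) = m%:R.
Proof. by rewrite -[m%:R : R[i]]mulr1n mulr1n normcMn normc1. Qed.

Lemma normc_le_ReIm z : normc z <= `|complex.Re z| + `|complex.Im z|.
Proof.
case: z => a b /=; rewrite -[leRHS]ger0_norm ?addr_ge0// -sqrtr_sqr.
rewrite ler_wsqrtr// sqrrD !real_normK ?num_real//.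
by rewrite addrAC lerDl mulrn_wge0// mulr_ge0.
Qed.

Lemma normRe_le z : `|complex.Re z| <= normc z.
Proof. by case: z => a b /=; rewrite -sqrtr_sqr ler_wsqrtr// lerDl sqr_ge0. Qed.

Lemma normIm_le z : `|complex.Im z| <= normc z.
Proof. by case: z => a b /=; rewrite -sqrtr_sqr ler_wsqrtr// lerDr sqr_ge0. Qed.

Lemma normc_sqr z : normc z ^+ 2 = complex.Re z ^+ 2 + complex.Im z ^+ 2.
Proof. by case: z => a b; rewrite /= sqr_sqrtr// addr_ge0 ?sqr_ge0. Qed.

End complex_norm.

Section polydisc.
Variables (R : realType) (n : nat).
Implicit Types (x y : 'rV[R[i]]_n) (r e : R).

Lemma sup_norm_ge0 x : 0 <= sup_norm x.
Proof. exact: bigmax_ge_id. Qed.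

Lemma le_sup_norm x i : normc (x 0 i) <= sup_norm x.
Proof. exact: (le_bigmax_cond _ (fun i => normc (x 0 i))). Qed.

Lemma sup_norm_leP x r : 0 <= r ->
  reflect (forall i, normc (x 0 i) <= r) (sup_norm x <= r).
Proof.
move=> r0; apply: (iffP idP) => [xr i|xr].
  exact: le_trans (le_sup_norm _ _) xr.
by apply/bigmax_leP; split.
Qed.

Lemma sup_norm_ltP x r : 0 < r ->
  reflect (forall i, normc (x 0 i) < r) (sup_norm x < r).
Proof.
move=> r0; apply: (iffP idP) => [xr i|xr].
  exact: le_lt_trans (le_sup_norm _ _) xr.
by apply/bigmax_ltP; split.
Qed.

Lemma sup_norm_attained x : (0 < n)%N -> exists i, sup_norm x = normc (x 0 i).
Proof.
case: n x => // m x _; rewrite /sup_norm.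
by rewrite (@bigmax_eq_arg _ _ _ _ ord0)//; [eexists|move=> i _; exact: normc_ge0].
Qed.

Lemma sup_norm0 : sup_norm (0 : 'rV[R[i]]_n) = 0.
Proof.
apply/eqP; rewrite eq_le sup_norm_ge0 andbT.
by apply/sup_norm_leP => // i; rewrite mxE normc0.
Qed.

Lemma sup_norm_eq0 x : sup_norm x = 0 -> x = 0.
Proof.
move=> x0; apply/rowP => i; rewrite mxE; apply: eq0_normc; apply/eqP.
by rewrite eq_le normc_ge0 -{1}x0 le_sup_norm.
Qed.

Lemma sup_normD x y : sup_norm (x + y) <= sup_norm x + sup_norm y.
Proof.
apply/sup_norm_leP => [|i]; first by rewrite addr_ge0 ?sup_norm_ge0.
by rewrite mxE (le_trans (le_normcD _ _))// lerD ?le_sup_norm.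
Qed.

Lemma sup_normZ (a : R[i]) x : sup_norm (a *: x) <= normc a * sup_norm x.
Proof.
apply/sup_norm_leP => [|i]; first by rewrite mulr_ge0 ?sup_norm_ge0 ?normc_ge0.
by rewrite mxE normcM ler_wpM2l ?le_sup_norm ?normc_ge0.
Qed.

Lemma sup_norm_distC x y : sup_norm (x - y) = sup_norm (y - x).
Proof. by apply: eq_bigr => i _; rewrite !mxE normc_distC. Qed.

Lemma sup_norm_dist_le x y : `|sup_norm x - sup_norm y| <= sup_norm (x - y).
Proof.
have h (u v : 'rV[R[i]]_n) : sup_norm u - sup_norm v <= sup_norm (u - v).
  by rewrite lerBlDr; have := sup_normD (u - v) v; rewrite subrK.
by rewrite ler_norml h andbT lerNl opprB sup_norm_distC h.
Qed.

(** Radii in the normed structure of [R[i]] are themselves complex; a positive one has zero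
    imaginary part, so real radii give the same neighbourhoods. *)
Lemma nbhs_sup_normP x (P : set 'rV[R[i]]_n) :
  nbhs x P <-> exists2 r : R, 0 < r & forall y, sup_norm (y - x) < r -> P y.
Proof.
split=> [/nbhs_ballP[e /= e0 xeP]|[r r0 xrP]].
  case: e e0 xeP => e e' /=; rewrite ltcE/= => /andP[/eqP e'0 e0] xeP.
  subst e'; exists e => // y; move/(sup_norm_ltP _ e0) => yx.
  apply: xeP; split; first by rewrite ltcR.
  move=> i j; rewrite ord1 -ball_normE /= normr_normc ltcR normc_distC.
  by have := yx j; rewrite !mxE.
apply/nbhs_ballP; exists (r%:C)%C => [|y [_ xy]]; first by rewrite /= ltcR.
apply: xrP; apply/(sup_norm_ltP _ r0) => i; have := xy 0 i.
by rewrite -ball_normE /= normr_normc ltcR normc_distC !mxE.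
Qed.

(** Squares rather than discs: they are images of products of two real segments, hence compact. *)
Let square r : set R[i] :=
  [set z | `|complex.Re z| <= r /\ `|complex.Im z| <= r].

Let compact_square r : compact (square r).
Proof.
have -> : square r =
    (fun p : R * R => (p.1 +i* p.2)%C) @` (`[- r, r] `*` `[- r, r]).
  apply/seteqP; split=> [z [zr zi]|_ [[a b] /= [a_r b_r] <-]] /=.
    exists (complex.Re z, complex.Im z) => /=; last by case: z {zr zi}.
    by rewrite !in_itv/= -!ler_norml.
  by move: a_r b_r; rewrite !in_itv/= -!ler_norml.
apply: continuous_compact; last by apply: compact_setX; exact: segment_compact.
apply: continuous_subspaceT => -[a b]; apply/cvgrPdist_lt => e.
case: e => e e'; rewrite ltcE/= => /andP[/eqP e'0 e0]; subst e'.
have e20 : 0 < e / 2 by rewrite divr_gt0.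
near=> p; rewrite normr_normc ltcR (le_lt_trans (normc_le_ReIm _))// (splitr e).
rewrite /= ltrD//; near: p.
  have /cvgrPdist_lt/(_ _ e20) : (fun p : R * R => p.1) @ (a, b) --> a
    by exact: cvg_fst.
  exact.
have /cvgrPdist_lt/(_ _ e20) : (fun p : R * R => p.2) @ (a, b) --> b
  by exact: cvg_snd.
exact.
Unshelve. all: by end_near. Qed.

Lemma continuous_at_sup_norm (F : 'rV[R[i]]_n -> R) x :
  (forall e, 0 < e ->
    exists2 t, 0 < t & forall y, sup_norm (y - x) < t -> `|F x - F y| < e) ->
  {for x, continuous F}.
Proof.
move=> h; apply/(@cvgrPdist_lt _ _ _ (nbhs x) (nbhs_filter x) F (F x)) => e e0.
by apply/nbhs_sup_normP; exact: h.
Qed.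

Lemma compact_sup_norm (c r : R) :
  compact [set x : 'rV[R[i]]_n | c <= sup_norm x <= r].
Proof.
apply: (@subclosed_compact _ _ [set x : 'rV[R[i]]_n | forall i,
  square r (x ord0 i)]).
- rewrite (_ : mkset _ = (@sup_norm R n) @^-1` `[c, r]); last first.
    by apply/seteqP; split=> x /=; rewrite in_itv.
  apply: closed_comp; last exact: interval_closed.
  move=> x _; apply: continuous_at_sup_norm => e e0; exists e => // y xy.
  by rewrite (le_lt_trans (sup_norm_dist_le _ _))// sup_norm_distC.
- exact: (@rV_compact _ n (fun=> square r)).
- move=> x /= /andP[_ xr] i; have := le_sup_norm x i.
  by split; [apply: le_trans (normRe_le _) _|apply: le_trans (normIm_le _) _];
    apply: le_trans xr.
Qed.

Lemma sup_norm_EVT (c r : R) (F : 'rV[R[i]]_n -> R) :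
  (exists x : 'rV[R[i]]_n, c <= sup_norm x <= r) ->
  (forall x, c <= sup_norm x <= r -> {for x, continuous F}) ->
  exists2 x, c <= sup_norm x <= r &
    forall y, c <= sup_norm y <= r -> F x <= F y.
Proof.
move=> [x0 x0K] Fcont.
have [||x + xmin] := @compact_EVT_min _ _ F _ _ (@compact_sup_norm c r).
- by exists x0.
- apply: continuous_in_subspaceT => x; rewrite inE => xK.
  exact: Fcont.
rewrite inE => xK; exists x => // y yK; apply: xmin; exact: mem_set.
Qed.

(** A quadratic remainder is what the series estimates provide; it yields both the existence of the
    limit and its value. *)
Lemma partial_eq (f : 'rV[R[i]]_n -> R[i]) (i : 'I_n) x (D : R[i]) (c r : R) :
  0 < r ->
  (forall t : R[i], normc t < r ->
    normc (f (x + t *: delta_mx 0 i) - f x - t * D) <= c * normc t ^+ 2) ->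
  partial i f x = D.
Proof.
move=> r0 h; rewrite /partial /derive; apply: cvg_lim; first exact: norm_hausdorff.
apply/cvgrPdist_lt => e; case: e => e e'.
rewrite ltcE/= => /andP[/eqP e'0 e0]; subst e'.
have c0 : 0 < `|c| + 1 by rewrite ltr_wpDl.
have d0 : 0 < Num.min r (e / (`|c| + 1)) by rewrite lt_min r0 divr_gt0.
rewrite /dnbhs; apply/nbhs_ballP.
exists (Num.min r (e / (`|c| + 1)))%:C%C; first by rewrite /= ltcR.
move=> t; rewrite -ball_normE /= sub0r normrN normr_normc ltcR lt_min => /andP[tr te] t0.
rewrite normr_normc ltcR.
suff : normc (D - t^-1 * (f (t *: delta_mx 0 i + x) - f x)) < e by [].
have nt0 : 0 < normc t by rewrite normc_gt0.
rewrite -(ltr_pM2l nt0) -normcM mulrBr mulrA mulfV// mul1r normc_distC.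
rewrite [X in f X]addrC.
apply: le_lt_trans (h _ tr) _; rewrite expr2 mulrCA ltr_pM2l//.
rewrite (le_lt_trans (y := (`|c| + 1) * normc t))//; last first.
  by rewrite mulrC -ltr_pdivlMr.
by rewrite ler_pM2r// (le_trans (ler_norm _))// lerDl.
Qed.

End polydisc.

(** * Polynomials along complex lines *)

Local Arguments normc : simpl never.

Section coefficient_norm.
Variable R : realType.
Implicit Types (p q : {poly R[i]}) (t : R[i]) (rho B : R).

(** A bound on the [l^1] norm of the coefficients weighted by powers of [rho]. Quantifying over [N]
    keeps the degree of [p] out of the statements. *)
Definition coef_norm_le rho p B :=
  forall N, \sum_(m < N) normc p`_m * rho ^+ m <= B.

Lemma coef_norm_leC rho (z : R[i]) : coef_norm_le rho z%:P (normc z).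
Proof.
case=> [|N]; first by rewrite big_ord0 normc_ge0.
rewrite big_ord_recl coefC /= expr0 mulr1 big1 ?addr0// => i _.
by rewrite coefC /= normc0 mul0r.
Qed.

Lemma coef_norm_leZ rho p (z : R[i]) B :
  coef_norm_le rho p B -> coef_norm_le rho (z *: p) (normc z * B).
Proof.
move=> pB N; rewrite (eq_bigr (fun m : 'I_N => normc z * (normc p`_m * rho ^+ m))).
  by rewrite -big_distrr ler_wpM2l ?normc_ge0 ?pB.
by move=> m _; rewrite coefZ normcM mulrA.
Qed.

Lemma coef_norm_le_sum rho (I : Type) (s : seq I) (P : I -> {poly R[i]})
    (B : I -> R) : 0 <= rho ->
  (forall i, coef_norm_le rho (P i) (B i)) ->
  coef_norm_le rho (\sum_(i <- s) P i) (\sum_(i <- s) B i).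
Proof.
move=> rho0 PB N.
apply: (@le_trans _ _ (\sum_(i <- s) \sum_(m < N) normc (P i)`_m * rho ^+ m)).
  rewrite exchange_big /=; apply: ler_sum => m _.
  by rewrite -big_distrl /= ler_wpM2r ?exprn_ge0// coef_sum le_normc_sum.
by apply: ler_sum => i _; exact: PB.
Qed.

(** Linear factors suffice: a monomial restricted to a line is a product of them. *)
Lemma coef_norm_leMlin rho p B (a b : R[i]) : 0 <= rho ->
  coef_norm_le rho p B ->
  coef_norm_le rho (p * (a%:P + b *: 'X)) (B * (normc a + rho * normc b)).
Proof.
move=> rho0 pB N.
apply: (@le_trans _ _ ((\sum_(m < N) normc p`_m * rho ^+ m) * normc a +
    (\sum_(m < N.-1) normc p`_m * rho ^+ m) * (rho * normc b))); last first.
  by rewrite mulrDr lerD// ler_wpM2r ?mulr_ge0 ?normc_ge0 ?pB.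
have co m : (p * (a%:P + b *: 'X))`_m =
    p`_m * a + (if m is m'.+1 then p`_m' * b else 0).
  rewrite mulrDr coefD coefMC -scalerAr coefZ coefMX.
  by case: m => [|m] /=; rewrite ?mulr0 // [b * _]mulrC.
apply: (@le_trans _ _ (\sum_(m < N) (normc p`_m * rho ^+ m * normc a +
    normc (if m : nat is m'.+1 then p`_m' * b else 0) * rho ^+ m))).
  apply: ler_sum => m _.
  rewrite co mulrAC -mulrDl ler_wpM2r ?exprn_ge0//.
  by rewrite (le_trans (le_normcD _ _))// normcM.
rewrite big_split /= big_distrl /= lerD2l.
case: N => [|N]; first by rewrite !big_ord0 mul0r.
rewrite big_ord_recl /= normc0 mul0r add0r big_distrl /=.
apply: ler_sum => m _; rewrite /bump /= add1n normcM exprS.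
by rewrite le_eqVlt; apply/orP; left; apply/eqP; ring.
Qed.

Lemma coef_norm_leMlinX rho p B (a b : R[i]) e : 0 <= rho ->
  coef_norm_le rho p B ->
  coef_norm_le rho (p * (a%:P + b *: 'X) ^+ e)
    (B * (normc a + rho * normc b) ^+ e).
Proof.
move=> rho0; elim: e p B => [|e IH] p B pB; first by rewrite !expr0 !mulr1.
by rewrite !exprS !mulrA; apply: IH; exact: coef_norm_leMlin.
Qed.

(** In degree [m >= N], [|t|^m = rho^m (|t|/rho)^m], and the last factor is at most
    [(|t|/rho)^N]. *)
Lemma coef_norm_taylor rho p B t N : 0 < rho -> coef_norm_le rho p B ->
  normc t <= rho ->
  normc (p.[t] - \sum_(m < N) p`_m * t ^+ m) <= B * (normc t / rho) ^+ N.
Proof.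
move=> rho0 pB trho.
have tr0 : 0 <= normc t / rho by rewrite divr_ge0 ?normc_ge0 ?ltW.
have tr1 : normc t / rho <= 1 by rewrite ler_pdivrMr// mul1r.
(* Padding with zero coefficients allows the split at [N] even beyond the degree. *)
rewrite (@horner_coef_wide _ (N + size p)) ?leq_addl// big_split_ord /=.
rewrite addrAC subrr add0r; apply: le_trans (le_normc_sum _ _ _) _.
have := pB (N + size p)%N; rewrite big_split_ord /= => h.
have h' : \sum_(m < size p) normc p`_(N + m) * rho ^+ (N + m) <= B.
  apply: le_trans h; rewrite lerDr sumr_ge0// => m _.
  by rewrite mulr_ge0 ?normc_ge0// exprn_ge0 ?ltW.
apply: le_trans (ler_wpM2r (exprn_ge0 N tr0) h').
rewrite big_distrl /=; apply: ler_sum => m _.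
rewrite normcM normcX -mulrA ler_wpM2l ?normc_ge0//.
rewrite -{1}(divfK (lt0r_neq0 rho0) (normc t)) exprMn mulrC.
rewrite (ler_wpM2l (exprn_ge0 _ (ltW rho0)))// exprD.
by rewrite ler_piMr ?exprn_ge0// exprn_ile1.
Qed.

(* The four-point mean kills the coefficients of degree 1, 2 and 3. *)
Lemma coef_norm_mean rho p B t : 0 < rho -> coef_norm_le rho p B ->
  normc t <= rho ->
  normc ((\sum_(m < 4) p.['i%C ^+ m * t]) / 4%:R - p`_0)
    <= B * (normc t / rho) ^+ 4.
Proof.
move=> rho0 pB trho.
have ni m : normc ('i%C ^+ m * t : R[i]) = normc t.
  by rewrite normcM normcX /normc/= expr0n/= add0r expr1n sqrtr1 expr1n mul1r.
have T m := @coef_norm_taylor rho p B ('i%C ^+ m * t) 4 rho0 pB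
  (eq_ind_r (fun z => z <= rho) trho (ni m)).
have i2 : ('i%C : R[i]) ^+ 2 = -1 by rewrite sqr_i.
have i3 : ('i%C : R[i]) ^+ 3 = - 'i%C by rewrite exprS i2 mulrN1.
have E : (\sum_(m < 4) p.['i%C ^+ m * t]) / 4%:R - p`_0 = 4%:R^-1 *
   \sum_(m < 4) (p.['i%C ^+ m * t] -
      \sum_(l < 4) p`_l * ('i%C ^+ m * t) ^+ l).
  rewrite !big_ord_recr !big_ord0 /= !add0r !exprMn -!exprM.
  rewrite ?mul0n ?muln0 ?mul1n ?muln1 !expr0 !expr1.
  have ii : 'i%C * 'i%C = -1 :> R[i] by rewrite -expr2 i2.
  rewrite ?(i2, i3) ?(mulNr, mulrN, mul1r, ii, opprK, mulr1).
  by field.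
rewrite E normcM normcV normc_nat ler_pdivrMl//.
apply: le_trans (le_normc_sum _ _ _) _.
apply: (@le_trans _ _ (\sum_(m < 4) B * (normc t / rho) ^+ 4)).
  by apply: ler_sum => m _; have := T m; rewrite ni.
by rewrite sumr_const card_ord mulr_natl.
Qed.

End coefficient_norm.

(** * Limits and multivariate power series *)

Section complex_limit.
Variable R : realType.
Implicit Types (u v : nat -> R[i]) (l z : R[i]).

Definition lim_to u l :=
  forall e : R, 0 < e -> exists N, forall m, (N <= m)%N -> normc (u m - l) < e.

Lemma lim_to_dist_le u l z (B : R) N : lim_to u l ->
  (forall m, (N <= m)%N -> normc (u m - z) <= B) -> normc (l - z) <= B.
Proof.
move=> ul uB; apply/ler_addgt0Pr => e e0; have [N' uN'] := ul _ e0.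
have := uN' _ (leq_maxr N N'); have := uB _ (leq_maxl N N').
set w := u _ => wB wl; rewrite -(subrK w l) -addrA.
by rewrite (le_trans (le_normcD _ _))// [leRHS]addrC lerD// normc_distC ltW.
Qed.

Lemma lim_to_unique u l l' : lim_to u l -> lim_to u l' -> l = l'.
Proof.
move=> ul ul'; apply/eqP; rewrite -subr_eq0 -normc_eq0 eq_le normc_ge0 andbT.
apply/ler_addgt0Pr => e e0; rewrite add0r.
have [N uN] := ul' _ e0; apply: (lim_to_dist_le ul (N := N)) => m /uN.
exact: ltW.
Qed.

Lemma lim_to_ext u v l N : (forall m, (N <= m)%N -> u m = v m) ->
  lim_to u l -> lim_to v l.
Proof.
move=> uv ul e /ul[N' h]; exists (maxn N N') => m; rewrite geq_max => /andP[Nm].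
by rewrite -uv//; exact: h.
Qed.

Lemma lim_to_cst l : lim_to (fun=> l) l.
Proof. by move=> e e0; exists 0%N => m _; rewrite subrr normc0. Qed.

Lemma lim_toD u v l l' : lim_to u l -> lim_to v l' ->
  lim_to (fun m => u m + v m) (l + l').
Proof.
move=> ul vl e e0; have e20 : 0 < e / 2 by rewrite divr_gt0.
have [[N h] [N' h']] := (ul _ e20, vl _ e20).
exists (maxn N N') => m; rewrite geq_max => /andP[/h ? /h' ?].
rewrite opprD addrACA (le_lt_trans (le_normcD _ _))// (splitr e).
exact: ltrD.
Qed.

Lemma lim_toZ u l z : lim_to u l -> lim_to (fun m => z * u m) (z * l).
Proof.
move=> ul e e0; have z0 : 0 < normc z + 1 by rewrite ltr_wpDl// normc_ge0.
have [N h] := ul _ (divr_gt0 e0 z0); exists N => m /h.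
rewrite ltr_pdivlMr// -mulrBr normcM; apply: le_lt_trans.
by rewrite mulrC ler_wpM2l ?normc_ge0// lerDl.
Qed.

Lemma lim_toB u v l l' : lim_to u l -> lim_to v l' ->
  lim_to (fun m => u m - v m) (l - l').
Proof.
move=> ul vl; rewrite -mulN1r; under eq_fun do rewrite -mulN1r.
by apply: lim_toD => //; exact: lim_toZ.
Qed.

Lemma lim_to_sum (I : Type) (s : seq I) (u : I -> nat -> R[i]) (l : I -> R[i]) :
  (forall i, lim_to (u i) (l i)) ->
  lim_to (fun m => \sum_(i <- s) u i m) (\sum_(i <- s) l i).
Proof.
move=> ul; elim: s => [|i s IH].
  by rewrite big_nil; under eq_fun do rewrite big_nil; exact: lim_to_cst.
by rewrite big_cons; under eq_fun do rewrite big_cons; exact: lim_toD.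
Qed.

(* Adding [T] to the real and imaginary parts of [u] makes them monotone. *)
Lemma lim_to_exists u (T : nat -> R) (B : R) :
  (forall m, T m <= B) ->
  (forall m m', (m <= m')%N -> normc (u m' - u m) <= T m' - T m) ->
  exists l, lim_to u l.
Proof.
move=> TB uT.
have cvg_monotone (v : nat -> R) (c : R) : (forall m, v m <= c) ->
    (forall m m', (m <= m')%N -> v m <= v m') ->
    exists l : R, forall e, 0 < e -> exists N, forall m, (N <= m)%N ->
      `|v m - l| < e.
  move=> vc vinc; have : cvgn v.
    apply: nondecreasing_is_cvgn; first exact: vinc.
    by exists c => _ [m _ <-].
  move=> /cvg_ex[l /cvgrPdist_lt vl]; exists l => e /vl[N _ h].
  by exists N => m Nm; rewrite distrC; exact: h.
have Tinc m m' : (m <= m')%N -> T m <= T m'.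
  by move=> mm'; rewrite -subr_ge0 (le_trans (normc_ge0 _) (uT _ _ mm')).
have [L TL] := cvg_monotone _ _ TB Tinc.
have cvg_part (p : {additive R[i] -> R}) : (forall z, `|p z| <= normc z) ->
    exists l : R, forall e, 0 < e -> exists N, forall m, (N <= m)%N ->
      `|p (u m) - l| < e.
  move=> pn.
  have [||l h] := cvg_monotone (fun m => p (u m) + T m)
      (`|p (u 0%N)| + (B - T 0%N) + B).
  - move=> m; rewrite lerD ?TB// -lerBlDl.
    rewrite (le_trans _ (le_trans (uT 0%N m (leq0n _)) _)) ?lerD2r ?TB//.
    apply: le_trans (pn _); rewrite raddfB/=.
    by rewrite (le_trans _ (ler_norm _))// lerD2l lerN2 ler_norm.
  - move=> m m' mm'; rewrite -subr_ge0 opprD addrACA -raddfB /=.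
    rewrite -lerBlDl sub0r (le_trans _ (uT _ _ mm'))//.
    by rewrite (le_trans _ (pn _))// ler_normr lexx orbT.
  exists (l - L) => e e0; have e20 : 0 < e / 2 by rewrite divr_gt0.
  have [[N hN] [N' hN']] := (h _ e20, TL _ e20).
  exists (maxn N N') => m; rewrite geq_max => /andP[/hN h1 /hN' h2].
  rewrite (_ : _ - _ = (p (u m) + T m - l) - (T m - L)); last by ring.
  by rewrite (le_lt_trans (ler_normB _ _))// (splitr e) ltrD.
have [a ha] := cvg_part (@complex.Re R) (@normRe_le R).
have [b hb] := cvg_part (@complex.Im R) (@normIm_le R).
exists (a +i* b)%C => e e0; have e20 : 0 < e / 2 by rewrite divr_gt0.
have [[N hN] [N' hN']] := (ha _ e20, hb _ e20).
exists (maxn N N') => m; rewrite geq_max => /andP[/hN h1 /hN' h2].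
rewrite (le_lt_trans (normc_le_ReIm _))// (splitr e) !raddfB /=.
exact: ltrD.
Qed.

End complex_limit.

Section exponents.
Variable n : nat.
Implicit Types k : {ffun 'I_n -> nat}.

Definition mdeg k : nat := (\sum_(i < n) k i)%N.

(** The subtraction is truncated when [k j = 0]; in a derivative the accompanying factor [k j] is
    then 0. *)
Definition mdec (j : 'I_n) k : {ffun 'I_n -> nat} :=
  [ffun l => (k l - (l == j))%N].

Definition box N : seq {ffun 'I_n -> nat} :=
  [seq [ffun i => nat_of_ord (k i)] | k : {ffun 'I_n -> 'I_N}].

Lemma mem_box N k : (k \in box N) = [forall i, (k i < N)%N].
Proof.
apply/mapP/forallP => [[k' _ -> i]|h]; first by rewrite ffunE.
exists [ffun i => Ordinal (h i)]; first by rewrite mem_enum.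
by apply/ffunP => i; rewrite !ffunE.
Qed.

Lemma box_uniq N : uniq (box N).
Proof.
rewrite map_inj_uniq ?enum_uniq// => k k' /ffunP kk'; apply/ffunP => i.
by have := kk' i; rewrite !ffunE => /ord_inj.
Qed.

Lemma sub_box N N' : (N <= N')%N -> {subset box N <= box N'}.
Proof.
move=> NN' k; rewrite !mem_box => /forallP h; apply/forallP => i.
exact: leq_trans (h i) NN'.
Qed.

Lemma big_box_sub (V : nmodType) N N' (F : {ffun 'I_n -> nat} -> V) :
  (N <= N')%N ->
  \sum_(k <- box N) F k = \sum_(k <- box N' | k \in box N) F k.
Proof.
move=> NN'; rewrite -[RHS]big_filter; apply: perm_big; apply: uniq_perm.
- exact: box_uniq.
- by rewrite filter_uniq// box_uniq.
by move=> k; rewrite mem_filter andb_idr// => /(sub_box NN').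
Qed.

Lemma mdeg_mdec j k : (0 < k j)%N -> mdeg k = (mdeg (mdec j k)).+1.
Proof.
move=> kj; rewrite /mdeg (bigD1 j)//= [in RHS](bigD1 j)//= ffunE eqxx.
rewrite -addSn subn1 prednK//; congr addn; apply: eq_bigr => i /negbTE ij.
by rewrite ffunE ij subn0.
Qed.

Lemma le_mdeg k j : (k j <= mdeg k)%N.
Proof. by rewrite /mdeg (bigD1 j)//= leq_addr. Qed.

End exponents.

(** The sum over a cube factors into one geometric sum per coordinate, each at most 2. This is why
    the exponents are exhausted by cubes. *)
Lemma box_geometric_le (R : realType) n N (th : R) : 0 <= th -> th <= 2^-1 ->
  \sum_(k <- box n N) th ^+ mdeg k <= 2 ^+ n.
Proof.
move=> th0 th2.
have geom : \sum_(j < N) th ^+ j <= 2.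
  have : (1 - th) * \sum_(j < N) th ^+ j <= 1.
    by rewrite -opprB mulNr -subrX1 opprB gerBl exprn_ge0.
  have : 0 <= \sum_(j < N) th ^+ j by apply: sumr_ge0 => j _; exact: exprn_ge0.
  by nra.
rewrite big_image /=.
under eq_bigr => k _.
  rewrite /mdeg (_ : \sum_(i < n) _ = \sum_(i < n) k i)%N; last first.
    by apply: eq_bigr => i _; rewrite ffunE.
  rewrite -prodrXr; over.
rewrite -(bigA_distr_bigA (fun (i : 'I_n) (j : 'I_N) => th ^+ j)) /=.
rewrite prodr_const card_ord.
by rewrite lerXn2r ?nnegrE//; apply: sumr_ge0 => j _; exact: exprn_ge0.
Qed.

Section line_polynomial.
Variables (R : realType) (n : nat).
Implicit Types (x xi : 'rV[R[i]]_n) (E : {ffun 'I_n -> nat}) (t : R[i]).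

Definition line_poly x xi E : {poly R[i]} :=
  \prod_(i < n) ((x 0 i)%:P + xi 0 i *: 'X) ^+ E i.

Lemma horner_line_poly x xi E t :
  (line_poly x xi E).[t] = monomial E (x + t *: xi).
Proof.
rewrite /line_poly horner_prod; apply: eq_bigr => i _.
by rewrite horner_exp !hornerE !mxE [t * _]mulrC.
Qed.

Lemma coef1M (p q : {poly R[i]}) : (p * q)`_1 = p`_0 * q`_1 + p`_1 * q`_0.
Proof. by rewrite coefM !big_ord_recl big_ord0 addr0. Qed.

Lemma coef1_prod (I : eqType) (s : seq I) (p : I -> {poly R[i]}) : uniq s ->
  (\prod_(i <- s) p i)`_1 =
  \sum_(j <- s) (p j)`_1 * \prod_(i <- s | i != j) (p i)`_0.
Proof.
elim: s => [_|i s IH /andP[s_i us]]; first by rewrite !big_nil coef1.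
rewrite !big_cons coef1M IH// eqxx /= addrC; congr (_ + _).
  rewrite -horner_coef0 horner_prod [in RHS]big_seq_cond [in LHS]big_seq.
  congr (_ * _); apply: eq_big => [j|j _]; last by rewrite horner_coef0.
  by case: (eqVneq j i) => [->|_]; rewrite ?andbT// (negbTE s_i).
rewrite big_distrr /= big_seq [RHS]big_seq; apply: eq_bigr => j js.
rewrite big_cons (_ : i != j); first by rewrite mulrCA.
by apply: contraNneq s_i => ->.
Qed.

Lemma coef1_linX (a b : R[i]) e :
  ((a%:P + b *: 'X) ^+ e)`_1 = b * (e%:R * a ^+ e.-1).
Proof.
elim: e => [|e IH]; first by rewrite expr0 coef1 mul0r mulr0.
rewrite exprS coef1M IH -[in X in _ + X]horner_coef0.
rewrite !coefD !coefC !coefZ !coefX /= horner_exp !hornerE ?(mulr0, addr0, add0r, mulr1).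
by case: e {IH} => [|e] /=; rewrite -?natr1 ?exprS; ring.
Qed.

Lemma line_poly_coef1 x xi E : (line_poly x xi E)`_1 =
  \sum_(j < n) xi 0 j * ((E j)%:R * monomial (mdec j E) x).
Proof.
rewrite coef1_prod ?index_enum_uniq//; apply: eq_bigr => j _.
rewrite coef1_linX -!mulrA; congr (_ * (_ * _)).
rewrite /monomial [RHS](bigD1 j)//= ffunE eqxx subn1; congr (_ * _).
apply: eq_bigr => i /negbTE ij; rewrite ffunE ij subn0.
by rewrite -horner_coef0 horner_exp !hornerE ?(mulr0, addr0).
Qed.

(** Each linear factor has norm at most [|x_i| + rho |xi_i| <= r], and there are [mdeg E] of
    them. *)
Lemma line_poly_norm x xi E (rho r : R) : 0 <= rho ->
  sup_norm x + rho * sup_norm xi <= r ->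
  coef_norm_le rho (line_poly x xi E) (r ^+ mdeg E).
Proof.
move=> rho0 xr.
have h : coef_norm_le rho (line_poly x xi E)
    (\prod_(i < n) (normc (x 0 i) + rho * normc (xi 0 i)) ^+ E i).
  rewrite /line_poly; elim: (index_enum _) => [|i s IH].
    rewrite !big_nil => N; apply: le_trans (@coef_norm_leC R rho 1 N) _.
    by rewrite normc1.
  rewrite !big_cons mulrC [X in coef_norm_le _ _ X]mulrC.
  exact: coef_norm_leMlinX.
move=> N; apply: le_trans (h N) _; rewrite /mdeg -prodrXr.
apply: ler_prod => i _.
have le0 : 0 <= normc (x 0 i) + rho * normc (xi 0 i).
  by rewrite addr_ge0 ?mulr_ge0 ?normc_ge0.
rewrite exprn_ge0//= lerXn2r ?nnegrE//; last first.
  by rewrite (le_trans _ xr)// lerD ?ler_wpM2l ?le_sup_norm.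
rewrite (le_trans _ xr)// addr_ge0 ?mulr_ge0 ?sup_norm_ge0//.
Qed.

Lemma normc_monomial_le x E (r : R) :
  sup_norm x <= r -> normc (monomial E x) <= r ^+ mdeg E.
Proof.
move=> xr; rewrite normc_prod /mdeg -prodrXr; apply: ler_prod => i _.
rewrite normc_ge0 normcX lerXn2r ?nnegrE ?normc_ge0//.
  exact: le_trans (sup_norm_ge0 x) xr.
exact: le_trans (le_sup_norm _ _) xr.
Qed.

End line_polynomial.

(** * Power series: termwise differentiation and restriction to lines *)

Section series.
Variables (R : realType) (n : nat).
Local Notation expo := {ffun 'I_n -> nat}.
Implicit Types (x xi : 'rV[R[i]]_n) (b : expo -> R[i]) (E : expo -> expo).

(** The exponent is [E k] and not [k], so that termwise differentiation changes [b] and [E] but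
    keeps the index set. *)
Definition ser b E N x := \sum_(k <- box n N) b k * monomial (E k) x.

Definition dominated (r M th : R) b E :=
  (forall k, normc (b k) * r ^+ mdeg (E k) <= M * th ^+ mdeg k) /\
  (forall k j, (E k j <= k j)%N).

Lemma sum_dominated_le (r M th : R) b E N : 0 <= th -> th <= 2^-1 ->
  dominated r M th b E -> 0 <= M ->
  \sum_(k <- box n N) normc (b k) * r ^+ mdeg (E k) <= M * 2 ^+ n.
Proof.
move=> th0 th2 [bE _] M0.
apply: (@le_trans _ _ (\sum_(k <- box n N) M * th ^+ mdeg k)).
  by apply: ler_sum => k _.
by rewrite -big_distrr ler_wpM2l ?box_geometric_le.
Qed.

Lemma box_sum_exists (c : expo -> R[i]) (d : expo -> R) (B : R) :
  (forall k, normc (c k) <= d k) ->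
  (forall N, \sum_(k <- box n N) d k <= B) ->
  exists l, lim_to (fun N => \sum_(k <- box n N) c k) l.
Proof.
move=> cd dB.
have diff (V : zmodType) (F : expo -> V) N N' : (N <= N')%N ->
    \sum_(k <- box n N') F k - \sum_(k <- box n N) F k =
    \sum_(k <- box n N' | k \notin box n N) F k.
  move=> NN'; rewrite (bigID (fun k => k \in box n N)) /=.
  by rewrite -big_box_sub// addrAC subrr add0r.
apply: (lim_to_exists dB) => N N' NN'; rewrite !diff//.
apply: le_trans (le_normc_sum _ _ _) _.
by apply: ler_sum.
Qed.

Lemma ser_exists (r M th : R) b E x : 0 <= th -> th <= 2^-1 -> 0 <= M ->
  dominated r M th b E -> sup_norm x <= r ->
  exists l, lim_to (fun N => ser b E N x) l.
Proof.
move=> th0 th2 M0 bE xr.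
apply: (@box_sum_exists _ (fun k => normc (b k) * r ^+ mdeg (E k)) (M * 2 ^+ n)).
  by move=> k; rewrite normcM ler_wpM2l ?normc_ge0 ?normc_monomial_le.
by move=> N; exact: sum_dominated_le bE M0.
Qed.

Definition dcoef j b E : expo -> R[i] := fun k => b k * (E k j)%:R.
Definition dexpo j E : expo -> expo := fun k => mdec j (E k).

(** The new factor [E k j] is at most [2 ^ mdeg k], which doubling [th] absorbs; the lost power of
    [r] turns [M] into [M / r]. *)
Lemma dominated_derive (r M th : R) b E j : 0 < r -> 0 <= th -> 0 <= M ->
  dominated r M th b E ->
  dominated r (M / r) (2 * th) (dcoef j b E) (dexpo j E).
Proof.
move=> r0 th0 M0 [bE Ek]; split=> [k|k l]; last first.
  by rewrite ffunE (leq_trans (leq_subr _ _)).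
have RHS0 : 0 <= M / r * (2 * th) ^+ mdeg k.
  by rewrite mulr_ge0 ?divr_ge0 ?exprn_ge0 ?mulr_ge0 ?(ltW r0).
rewrite /dcoef /dexpo normcM normc_nat; case: (posnP (E k j)) => [->|Ekj].
  by rewrite mulr0 mul0r.
rewrite -(ler_pM2r r0) [M / r * _]mulrAC divfK ?lt0r_neq0// -!mulrA -exprSr.
rewrite -mdeg_mdec// [leLHS]mulrCA exprMn [leRHS]mulrCA.
rewrite ler_pM//.
- by rewrite mulr_ge0 ?normc_ge0 ?exprn_ge0 ?ltW.
- rewrite -natrX ler_nat; apply: (@leq_trans (2 ^ E k j)); first by rewrite ltnW// ltn_expl.
  by rewrite leq_exp2l// (leq_trans (Ek k j))// le_mdeg.
Qed.

Definition ser_poly b E N x xi := \sum_(k <- box n N) b k *: line_poly x xi (E k).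

Lemma horner_ser_poly b E N x xi t :
  (ser_poly b E N x xi).[t] = ser b E N (x + t *: xi).
Proof.
by rewrite horner_sum; apply: eq_bigr => k _; rewrite hornerZ horner_line_poly.
Qed.

Lemma ser_poly_coef0 b E N x xi : (ser_poly b E N x xi)`_0 = ser b E N x.
Proof. by rewrite -horner_coef0 horner_ser_poly scale0r addr0. Qed.

Lemma ser_poly_coef1 b E N x xi : (ser_poly b E N x xi)`_1 =
  \sum_(j < n) xi 0 j * ser (dcoef j b E) (dexpo j E) N x.
Proof.
rewrite coef_sum; under eq_bigr => k _.
  rewrite coefZ line_poly_coef1 big_distrr /=; over.
rewrite exchange_big /=; apply: eq_bigr => j _; rewrite big_distrr /=.
by apply: eq_bigr => k _; rewrite mulrCA !mulrA.
Qed.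

Lemma ser_poly_norm b E N x xi (rho r B : R) : 0 <= rho ->
  sup_norm x + rho * sup_norm xi <= r ->
  \sum_(k <- box n N) normc (b k) * r ^+ mdeg (E k) <= B ->
  coef_norm_le rho (ser_poly b E N x xi) B.
Proof.
move=> rho0 xr bB N'; apply: le_trans bB.
apply: (@coef_norm_le_sum _ _ _ _ _ (fun k => normc (b k) * r ^+ mdeg (E k))) => //.
by move=> k; apply: coef_norm_leZ; exact: line_poly_norm.
Qed.

Variables (r B : R) (b : expo -> R[i]) (E : expo -> expo) (G : 'rV[R[i]]_n -> R[i]).
Hypothesis bB : forall N, \sum_(k <- box n N) normc (b k) * r ^+ mdeg (E k) <= B.
Hypothesis GE : forall x, sup_norm x < r -> lim_to (fun N => ser b E N x) (G x).

Section line.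
Variables (x xi : 'rV[R[i]]_n) (rho : R).
Hypothesis rho0 : 0 < rho.
Hypothesis xr : sup_norm x + rho * sup_norm xi < r.

Let line_lt t : normc t <= rho -> sup_norm (x + t *: xi) < r.
Proof.
move=> trho; apply: le_lt_trans xr; rewrite (le_trans (sup_normD _ _))//.
by rewrite lerD2l (le_trans (sup_normZ _ _))// ler_wpM2r ?sup_norm_ge0.
Qed.

Let x_lt : sup_norm x < r.
Proof. by have := @line_lt 0; rewrite scale0r addr0 normc0; apply; exact: ltW. Qed.

Let norm_le N : coef_norm_le rho (ser_poly b E N x xi) B.
Proof. by apply: (@ser_poly_norm _ _ _ _ _ _ r) => //; exact: ltW. Qed.

(** Every truncation is a polynomial in [t] with coefficient norm at most [B], whatever [N], so its
    Taylor bound survives the limit. [ser_line1] and [ser_mean] rest on the same remark. *)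
Lemma ser_line0 t : normc t <= rho ->
  normc (G (x + t *: xi) - G x) <= B * (normc t / rho).
Proof.
move=> trho.
rewrite -[X in normc X]subr0; apply: (@lim_to_dist_le _ _ _ _ _ 0%N
  (lim_toB (GE (line_lt trho)) (GE x_lt))) => N _.
have := @coef_norm_taylor _ _ _ _ _ 1 rho0 (norm_le N) trho.
by rewrite big_ord_recl big_ord0 addr0 horner_ser_poly ser_poly_coef0 mulr1 subr0.
Qed.

Lemma ser_line1 (D : 'I_n -> R[i]) t :
  (forall j, lim_to (fun N => ser (dcoef j b E) (dexpo j E) N x) (D j)) ->
  normc t <= rho ->
  normc (G (x + t *: xi) - G x - t * \sum_(j < n) xi 0 j * D j)
    <= B * (normc t / rho) ^+ 2.
Proof.
move=> DE trho.
rewrite -[X in normc X]subr0.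
have lD : lim_to (fun N => t * (ser_poly b E N x xi)`_1)
    (t * \sum_(j < n) xi 0 j * D j).
  apply: lim_toZ; under eq_fun do rewrite ser_poly_coef1.
  by apply: lim_to_sum => j; exact: lim_toZ.
apply: (@lim_to_dist_le _ _ _ _ _ 0%N
  (lim_toB (lim_toB (GE (line_lt trho)) (GE x_lt)) lD)) => N _.
have := @coef_norm_taylor _ _ _ _ _ 2 rho0 (norm_le N) trho.
rewrite !big_ord_recl big_ord0 addr0 horner_ser_poly ser_poly_coef0 mulr1 subr0.
by rewrite opprD addrA /= expr1 [_`_1 * t]mulrC.
Qed.

Lemma ser_mean t : normc t <= rho ->
  normc ((\sum_(m < 4) G (x + ('i%C ^+ m * t) *: xi)) / 4%:R - G x)
    <= B * (normc t / rho) ^+ 4.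
Proof.
move=> trho.
have ni m : normc ('i%C ^+ m * t : R[i]) <= rho.
  by rewrite normcM normcX /normc/= expr0n/= add0r expr1n sqrtr1 expr1n mul1r.
rewrite -[X in normc X]subr0.
have lM : lim_to (fun N => (\sum_(m < 4) (ser_poly b E N x xi).['i%C ^+ m * t]) / 4%:R)
    ((\sum_(m < 4) G (x + ('i%C ^+ m * t) *: xi)) / 4%:R).
  under eq_fun do rewrite mulrC; rewrite mulrC; apply: lim_toZ.
  apply: lim_to_sum => m; under eq_fun do rewrite horner_ser_poly.
  exact/GE/line_lt.
apply: (@lim_to_dist_le _ _ _ _ _ 0%N (lim_toB lM (GE x_lt))) => N _.
have := @coef_norm_mean _ _ _ _ _ rho0 (norm_le N) trho.
by rewrite ser_poly_coef0 subr0.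
Qed.

End line.
End series.

(** * Common zeros of n - 1 analytic functions *)

(** The form in which a parameter is let tend to 0; [t <= 1] is offered so that higher powers of [t]
    may be weakened to [t]. *)
Lemma le0_of_small_le (R : realType) (A C rho : R) : 0 < rho ->
  (forall t, 0 < t -> t <= rho -> t <= 1 -> A <= C * t) -> A <= 0.
Proof.
move=> rho0 h; rewrite leNgt; apply/negP => A0.
have C0 : 0 < `|C| + 1 by rewrite ltr_wpDl.
pose t := Num.min rho (Num.min 1 (A / (2 * (`|C| + 1)))).
have t0 : 0 < t by rewrite !lt_min rho0 ltr01 divr_gt0// mulr_gt0.
have := h t t0; rewrite /t !ge_min !lexx ?orbT => /(_ isT isT); apply/negP.
rewrite -ltNge -/t; have tA : t <= A / (2 * (`|C| + 1)) by rewrite !ge_min lexx !orbT.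
apply: (@le_lt_trans _ _ ((`|C| + 1) * t)).
  by rewrite ler_pM2r// (le_trans (ler_norm _))// lerDl.
apply: (@le_lt_trans _ _ (A / 2)); last by lra.
have -> : A / 2 = (`|C| + 1) * (A / (2 * (`|C| + 1))) by field; rewrite gt_eqF.
by rewrite ler_pM2l.
Qed.

Section four_points.
Variable R : realType.
Implicit Types z v : R[i].

Lemma normc_addsq z v : normc (z + v) ^+ 2 = normc z ^+ 2 +
  2 * (complex.Re z * complex.Re v + complex.Im z * complex.Im v) + normc v ^+ 2.
Proof. by rewrite !normc_sqr !raddfD /=; ring. Qed.

(** The cross terms cancel, as the four powers of [i] sum to 0. *)
Lemma four_point_sum_sq z v :
  \sum_(m < 4) normc (z + 'i%C ^+ m * v) ^+ 2 = 4 * normc z ^+ 2 + 4 * normc v ^+ 2.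
Proof.
rewrite !big_ord_recr big_ord0 /= !normc_sqr.
case: z => a b; case: v => c e; rewrite !exprS expr0 mulr1 /=.
ring.
Qed.

(** In the expansion of [|z0 + (z m - z0)|^2] the linear term sees only the mean of the increments,
    hence [K']. The constant 16 is [2 * 2 * 4]: real and imaginary parts are bounded separately,
    each by [|z0| * 4 K']. *)
Lemma four_point_sum_sq_le (z : 'I_4 -> R[i]) (z0 : R[i]) (K K' : R) :
  (forall m, normc (z m - z0) <= K) ->
  normc ((\sum_(m < 4) z m) / 4%:R - z0) <= K' ->
  \sum_(m < 4) normc (z m) ^+ 2 <=
    4 * normc z0 ^+ 2 + (16 * normc z0 * K' + 4 * K ^+ 2).
Proof.
move=> zK zK'; pose V := \sum_(m < 4) (z m - z0).
have -> : \sum_(m < 4) normc (z m) ^+ 2 = 4 * normc z0 ^+ 2 +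
   2 * (complex.Re z0 * complex.Re V + complex.Im z0 * complex.Im V) +
   \sum_(m < 4) normc (z m - z0) ^+ 2.
  rewrite (eq_bigr (fun m => normc z0 ^+ 2 +
    2 * (complex.Re z0 * complex.Re (z m - z0) +
         complex.Im z0 * complex.Im (z m - z0)) + normc (z m - z0) ^+ 2)).
    rewrite !big_split /= sumr_const card_ord -big_distrr /= big_split /=.
    by rewrite -!big_distrr /= /V !raddf_sum /= [4 * _]mulr_natl.
  by move=> m _; rewrite -normc_addsq addrC subrK.
have VK : normc V <= 4 * K'.
  rewrite /V sumrB sumr_const card_ord.
  have -> : \sum_(m < 4) z m - z0 *+ 4 = 4%:R * ((\sum_(m < 4) z m) / 4%:R - z0).
    by field.
  by rewrite normcM normc_nat ler_pM2l.
have ab (a b c e : R) : `|a| <= c -> `|b| <= e -> a * b <= c * e.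
  by move=> ac be; rewrite (le_trans (ler_norm _))// normrM ler_pM.
have h1 := ab _ _ _ _ (normRe_le z0) (le_trans (normRe_le V) VK).
have h2 := ab _ _ _ _ (normIm_le z0) (le_trans (normIm_le V) VK).
have h3 : \sum_(m < 4) normc (z m - z0) ^+ 2 <= 4 * K ^+ 2.
  apply: (@le_trans _ _ (\sum_(m < 4) K ^+ 2)).
    apply: ler_sum => m _; rewrite lerXn2r ?nnegrE ?normc_ge0//.
    exact: le_trans (normc_ge0 _) (zK m).
  by rewrite sumr_const card_ord mulr_natl.
lra.
Qed.

End four_points.

Lemma continuous_at_sum_sq (R : realType) (T : topologicalType) (x : T)
    (I : finType) (P : pred I) (F : I -> T -> R) :
  (forall i, P i -> {for x, continuous (F i)}) ->
  {for x, continuous (fun y => \sum_(i | P i) F i y ^+ 2)}.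
Proof.
move=> Fc; apply: (@cvg_big _ _ +%R) => [|i Pi]; first exact: add_continuous.
by apply: cvgM; exact: Fc.
Qed.

Lemma continuous_at_comb (R : realType) (T : topologicalType) (x : T)
    (M : R) (F G : T -> R) :
  {for x, continuous F} -> {for x, continuous G} ->
  {for x, continuous (fun y => M * F y - G y)}.
Proof.
by move=> Fc Gc; apply: cvgB => //; apply: cvgM => //; exact: cvg_cst.
Qed.

Section common_zero.
Variables (R : realType) (n : nat).
Local Notation expo := {ffun 'I_n -> nat}.
Implicit Types (x xi : 'rV[R[i]]_n).

(** The squared Euclidean norm has an exact four-point mean along a line, which [sup_norm] lacks;
    the balls and spheres are still those of [sup_norm]. *)
Definition norm2 x : R := \sum_(i < n) normc (x 0 i) ^+ 2.

Lemma norm2_gt0 x : x != 0 -> 0 < norm2 x.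
Proof.
move=> xn0; rewrite ltNge; apply: contraNN xn0 => x0.
apply/eqP/rowP => i; rewrite mxE; apply: eq0_normc.
have /eqP : norm2 x = 0.
  by apply/eqP; rewrite eq_le x0 sumr_ge0// => j _; exact: sqr_ge0.
rewrite psumr_eq0 => [/allP/(_ i)|j _]; last exact: sqr_ge0.
by rewrite mem_index_enum /= sqrf_eq0 => /(_ isT)/eqP.
Qed.

Lemma norm2_le x (r : R) : sup_norm x <= r -> norm2 x <= n%:R * r ^+ 2.
Proof.
move=> xr; apply: (@le_trans _ _ (\sum_(i < n) r ^+ 2)).
  apply: ler_sum => i _; have xi := le_trans (le_sup_norm x i) xr.
  by rewrite lerXn2r ?nnegrE ?normc_ge0// (le_trans _ xi) ?normc_ge0.
by rewrite sumr_const card_ord mulr_natl.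
Qed.

Lemma continuous_sum_sq (I : finType) (P : pred I)
    (g : I -> 'rV[R[i]]_n -> R[i]) x (L t : R) : 0 < t ->
  (forall i y, P i -> sup_norm (y - x) < t ->
    normc (g i y - g i x) <= L * sup_norm (y - x)) ->
  {for x, continuous (fun y => \sum_(i | P i) normc (g i y) ^+ 2)}.
Proof.
move=> t0 gL.
have gc i : P i -> {for x, continuous (fun y => normc (g i y))}.
  move=> Pi; apply: continuous_at_sup_norm => e e0.
  have L0 : 0 < `|L| + 1 by rewrite ltr_wpDl.
  exists (Num.min t (e / (`|L| + 1))); first by rewrite lt_min t0 divr_gt0.
  move=> y; rewrite lt_min => /andP[yt ye].
  apply: (@le_lt_trans _ _ (normc (g i y - g i x))).
    rewrite normc_distC ler_norml le_normcB andbT lerNl opprB.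
    by rewrite normc_distC le_normcB.
  apply: le_lt_trans (gL i y Pi yt) _.
  apply: (@le_lt_trans _ _ ((`|L| + 1) * sup_norm (y - x))).
    by rewrite ler_wpM2r ?sup_norm_ge0// (le_trans (ler_norm _))// lerDl.
  by rewrite mulrC -ltr_pdivlMr.
exact: continuous_at_sum_sq.
Qed.

Variables (i0 : 'I_n) (r B : R) (b : 'I_n -> expo -> R[i]).
Variables (E : 'I_n -> expo -> expo) (g : 'I_n -> 'rV[R[i]]_n -> R[i]).
Hypothesis bB : forall i N,
  \sum_(k <- box n N) normc (b i k) * r ^+ mdeg (E i k) <= B.
Hypothesis gE : forall i x, sup_norm x < r ->
  lim_to (fun N => ser (b i) (E i) N x) (g i x).
Hypothesis dgE : forall i j x, sup_norm x < r -> exists D,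
  lim_to (fun N => ser (dcoef j (b i) (E i)) (dexpo j (E i)) N x) D.
Hypothesis g0 : forall i, i != i0 -> g i 0 = 0.

Let S x := \sum_(i | i != i0) normc (g i x) ^+ 2.

Lemma ser_lipschitz i x : sup_norm x < r ->
  forall y, sup_norm (y - x) < (r - sup_norm x) / 2 ->
  normc (g i y - g i x) <= B / ((r - sup_norm x) / 2) * sup_norm (y - x).
Proof.
move=> xr y; set d := (r - sup_norm x) / 2 => yd.
have d0 : 0 < d by rewrite divr_gt0// subr_gt0.
have [yx|yx0] := eqVneq (sup_norm (y - x)) 0.
  have /eqP := sup_norm_eq0 yx; rewrite subr_eq0 => /eqP ->.
  by rewrite !subrr normc0 sup_norm0 mulr0.
have yx : 0 < sup_norm (y - x) by rewrite lt_neqAle eq_sym yx0 sup_norm_ge0.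
(* The line through [x] and [y] is taken with parameter [1]; the radius [d / |y - x|] keeps it
   within distance [d] of [x]. *)
have := @ser_line0 _ _ r B (b i) (E i) (g i) (bB i) (gE i) x (y - x)
  (d / sup_norm (y - x)) (divr_gt0 d0 yx) _ 1.
rewrite divfK// scale1r [x + (y - x)]addrC subrK normc1 ler_pdivlMr// mul1r => /(_ _ (ltW yd)).
rewrite div1r invf_div mulrA mulrAC => -> //.
by rewrite /d; have := xr; lra.
Qed.

Let S_continuous x : sup_norm x < r -> {for x, continuous S}.
Proof.
move=> xr; apply: (@continuous_sum_sq _ _ _ _ (B / ((r - sup_norm x) / 2))
  ((r - sup_norm x) / 2)); first by rewrite divr_gt0// subr_gt0.
by move=> i y _; exact: ser_lipschitz.
Qed.

Lemma norm2_continuous x : {for x, continuous norm2}.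
Proof.
apply: (@continuous_sum_sq _ predT (fun i y => y 0 i) _ 1 1) => // i y _ _.
by rewrite mul1r; have := le_sup_norm (y - x) i; rewrite !mxE.
Qed.

(* If [g] had no zero on the sphere, [M |g|^2 - |x|^2] would have an interior
   minimum [x0] for [M] large; but along a complex line through [x0] in the
   kernel of the differential of [g], which exists for lack of equations,
   [|g|^2] has no second-order variation in the mean while [|x|^2] increases. *)
Lemma common_zero_on_sphere (rr : R) : 0 < rr -> rr < r ->
  exists2 x, sup_norm x = rr & forall i, i != i0 -> g i x = 0.
Proof.
move=> rr0 rrr; apply: contrapT => noz.
have S_ge0 x : 0 <= S x by apply: sumr_ge0 => i _; exact: sqr_ge0.
have Sgt0 x : sup_norm x = rr -> 0 < S x.
  move=> xrr; rewrite lt_neqAle S_ge0 andbT eq_sym; apply/eqP => Sx.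
  apply: noz; exists x => // i ii0; apply: eq0_normc.
  have /eqP := Sx; rewrite psumr_eq0 => [/allP/(_ i)|j _]; last exact: sqr_ge0.
  by rewrite mem_index_enum ii0 /= sqrf_eq0 => /(_ isT)/eqP.
have sphere0 : sup_norm (const_mx rr%:C%C : 'rV[R[i]]_n) = rr.
  have [|i ->] := @sup_norm_attained R n (const_mx rr%:C%C).
    exact: leq_ltn_trans (leq0n _) (ltn_ord i0).
  by rewrite mxE normc_real gtr0_norm.
have [||x1] := @sup_norm_EVT R n rr rr S.
- by exists (const_mx rr%:C%C); rewrite sphere0 lexx.
- by move=> x /andP[_ xrr]; apply: S_continuous; exact: le_lt_trans xrr rrr.
rewrite -eq_le => /eqP x1rr x1min; have m0 := Sgt0 _ (esym x1rr).
(* With this [M], [psi] is positive on the sphere while [psi 0 = 0], so the minimum over the ball is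
   interior. *)
pose M := (n%:R * rr ^+ 2 + 1) / S x1.
have M0 : 0 <= M by rewrite divr_ge0 ?S_ge0// addr_ge0// mulr_ge0 ?sqr_ge0.
pose psi x := M * S x - norm2 x.
have [||x0 /andP[_ x0rr] x0min] := @sup_norm_EVT R n 0 rr psi.
- by exists (const_mx rr%:C%C); rewrite sphere0 lexx ltW.
- move=> x /andP[_ xrr].
  apply: continuous_at_comb; last exact: norm2_continuous.
  by apply: S_continuous; exact: le_lt_trans xrr rrr.
have psi0 : psi 0 = 0.
  rewrite /psi /S /norm2 !big1 ?mulr0 ?subr0// => i ii0.
    by rewrite mxE normc0 expr0n.
  by rewrite g0// normc0 expr0n.
have {}x0rr : sup_norm x0 < rr.
  rewrite lt_neqAle x0rr andbT; apply/eqP => x0E.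
  have : psi x0 <= 0 by rewrite -psi0 x0min// sup_norm0 lexx ltW.
  apply/negP; rewrite -ltNge subr_gt0 (le_lt_trans (norm2_le x0rr))//.
  rewrite /M mulrAC ltr_pdivlMr//.
  have := x1min x0; rewrite x0E lexx => /(_ isT) Sx.
  apply: lt_le_trans (_ : (n%:R * rr ^+ 2 + 1) * S x1 <= _).
    by rewrite ltr_pM2r// ltrDl.
  by rewrite ler_wpM2l// addr_ge0// mulr_ge0 ?sqr_ge0.
have x0r := lt_trans x0rr rrr.
have [D DE] : exists D : 'I_n -> 'I_n -> R[i], forall i j, lim_to
    (fun N => ser (dcoef j (b i) (E i)) (dexpo j (E i)) N x0) (D i j).
  have /choice[D hD] : forall ij : 'I_n * 'I_n, exists d, lim_to (fun N =>
      ser (dcoef ij.2 (b ij.1) (E ij.1)) (dexpo ij.2 (E ij.1)) N x0) d.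
    by move=> ij; exact: dgE.
  by exists (fun i j => D (i, j)) => i j; exact: (hD (i, j)).
(* The zero column stands for the missing equation and makes the determinant vanish. *)
pose J : 'M[R[i]]_n := \matrix_(j, i) (if i == i0 then 0 else D i j).
have [xi xi0 xiJ] : exists2 xi : 'rV[R[i]]_n, xi != 0 & xi *m J = 0.
  apply/det0P; rewrite (expand_det_col _ i0) big1// => j _.
  by rewrite mxE eqxx mul0r.
have ker i : i != i0 -> \sum_(j < n) xi 0 j * D i j = 0.
  move=> ii0; have /rowP/(_ i) := xiJ; rewrite !mxE => h.
  by apply: etrans h; apply: eq_bigr => j _; rewrite mxE (negbTE ii0).
pose rho := (rr - sup_norm x0) / (sup_norm xi + 1).
have xi1 : 0 < sup_norm xi + 1 by rewrite ltr_wpDl ?sup_norm_ge0.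
have rho0 : 0 < rho by rewrite divr_gt0// subr_gt0.
have x0rho : sup_norm x0 + rho * sup_norm xi < rr.
  rewrite -ltrBrDl /rho mulrAC ltr_pdivrMr// ltr_pM2l ?subr_gt0//.
  by rewrite ltrDl.
(* [t ^+ 4 * C i] is the error term of [four_point_sum_sq_le] for [K = B (t/rho)^2] and
   [K' = B (t/rho)^4]. *)
pose C i := 16 * normc (g i x0) * (B / rho ^+ 4) + 4 * (B / rho ^+ 2) ^+ 2.
have : 4 * norm2 xi <= 0; last first.
  by apply/negP; rewrite -ltNge mulr_gt0// norm2_gt0.
apply: (@le0_of_small_le _ _ (`|M * \sum_(i | i != i0) C i|) rho) => // t t0 trho t1.
pose p (m : 'I_4) := x0 + ('i%C ^+ m * t%:C%C) *: xi.
have nt : normc t%:C%C = t by rewrite normc_real gtr0_norm.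
have ni (m : nat) : normc ('i%C ^+ m * t%:C%C : R[i]) = t.
  rewrite normcM nt normcX /normc/= expr0n/= add0r expr1n sqrtr1 expr1n.
  by rewrite mul1r.
have psip m : psi x0 <= psi (p m).
  apply: x0min; rewrite sup_norm_ge0/= (le_trans (sup_normD _ _))//.
  rewrite (le_trans _ (ltW x0rho))// lerD2l (le_trans (sup_normZ _ _))// ni.
  by rewrite ler_wpM2r ?sup_norm_ge0.
have sum_norm2 : \sum_(m < 4) norm2 (p m) = 4 * norm2 x0 + 4 * t ^+ 2 * norm2 xi.
  rewrite exchange_big /= /norm2 !big_distrr -big_split /=; apply: eq_bigr => i _.
  under eq_bigr do rewrite !mxE -mulrA.
  rewrite four_point_sum_sq normcM nt exprMn; ring.
have sumS : \sum_(m < 4) S (p m) <= 4 * S x0 + t ^+ 4 * \sum_(i | i != i0) C i.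
  rewrite exchange_big /= !big_distrr -big_split /=; apply: ler_sum => i ii0.
  have h1 (m : 'I_4) : normc (g i (p m) - g i x0) <= B * (t / rho) ^+ 2.
    have := @ser_line1 _ _ r B (b i) (E i) (g i) (bB i) (gE i) x0 xi rho rho0
      (lt_trans x0rho rrr) _ ('i%C ^+ m * t%:C%C) (DE i).
    by rewrite ni ker// mulr0 subr0 => ->.
  have h2 := @ser_mean _ _ r B (b i) (E i) (g i) (bB i) (gE i) x0 xi rho rho0
    (lt_trans x0rho rrr) t%:C%C.
  rewrite nt in h2; have := four_point_sum_sq_le h1 (h2 trho).
  move/le_trans; apply; rewrite lerD2l /C.
  by rewrite le_eqVlt; apply/orP; left; apply/eqP; field; rewrite gt_eqF.
have : 4 * psi x0 <= \sum_(m < 4) psi (p m).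
  apply: (@le_trans _ _ (\sum_(m < 4) psi x0)); last exact: ler_sum.
  by rewrite sumr_const card_ord mulr_natl.
rewrite /psi sumrB -big_distrr /= sum_norm2.
have := ler_wpM2l M0 sumS.
set P := \sum_(m < 4) S (p m); set Q := \sum_(i | i != i0) C i => MS key.
have key2 : 4 * norm2 xi * t ^+ 2 <= M * Q * t ^+ 2 * t ^+ 2 by lra.
rewrite ler_pM2r ?exprn_gt0// in key2; apply: le_trans key2 _.
apply: (@le_trans _ _ (`|M * Q| * t ^+ 2)).
  by rewrite ler_wpM2r ?sqr_ge0// ler_norm.
by rewrite ler_wpM2l// expr2 ler_piMl// ltW.
Qed.

End common_zero.

(** * Weighted scaling and the principal part *)

Section analytic_partial.
Variables (R : realType) (n : nat).
Local Notation expo := {ffun 'I_n -> nat}.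

(** Bounded terms at one radius suffice, as in Abel's lemma: at a smaller radius they decay
    geometrically. *)
Definition has_series (F : 'rV[R[i]]_n -> R[i]) (a : expo -> R[i]) (r M : R) :=
  [/\ 0 < r, forall k, normc (a k) * r ^+ mdeg k <= M &
      forall x, sup_norm x < r -> lim_to (fun N => ser a id N x) (F x)].

(** The second derivatives are included because [common_zero_on_sphere] differentiates the functions
    it is given, here the first partials. *)
Lemma analytic_partial F a r0 M : has_series F a r0 M ->
  exists r B : R,
  [/\ 0 < r <= 1,
      forall i N, \sum_(k <- box n N) normc (dcoef i a id k) *
                    r ^+ mdeg (dexpo i id k) <= B,
      forall i x, sup_norm x < r ->
        lim_to (fun N => ser (dcoef i a id) (dexpo i id) N x) (partial i F x) &
      forall i j x, sup_norm x < r -> exists D, lim_to (fun N =>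
        ser (dcoef j (dcoef i a id) (dexpo i id)) (dexpo j (dexpo i id)) N x) D].
Proof.
move=> [r00 aM FE].
have M0 : 0 <= M.
  by rewrite (le_trans _ (aM [ffun=> 0%N]))// mulr_ge0 ?normc_ge0 ?exprn_ge0 ?ltW.
(* Shrinking the radius by 8 gives the decay ratio [1/8]; two differentiations double it to [1/2],
   the largest ratio allowed. The bound [1] makes powers of [r] decrease in [partial_hpart_le]. *)
pose r := Num.min (r0 / 8) 1.
have r_gt0 : 0 < r by rewrite lt_min divr_gt0/=.
have rr0 : r <= r0 / 8 by rewrite ge_min lexx.
have D0 : dominated r M 8^-1 a id.
  split=> // k; apply: (@le_trans _ _ (normc (a k) * (r0 / 8) ^+ mdeg k)).
    by rewrite ler_wpM2l ?normc_ge0// lerXn2r ?nnegrE ?divr_ge0 ?(ltW r_gt0) ?(ltW r00).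
  by rewrite exprMn mulrA ler_wpM2r ?exprn_ge0// invr_ge0.
have D1 i : dominated r (M / r) 4^-1 (dcoef i a id) (dexpo i id).
  rewrite (_ : 4^-1 = 2 * 8^-1 :> R); last by field.
  by apply: dominated_derive => //; rewrite invr_ge0.
have D2 i j : dominated r (M / r / r) 2^-1
    (dcoef j (dcoef i a id) (dexpo i id)) (dexpo j (dexpo i id)).
  rewrite (_ : 2^-1 = 2 * 4^-1 :> R); last by field.
  apply: dominated_derive => //; rewrite ?invr_ge0//.
  by rewrite divr_ge0// ltW.
have Mr : 0 <= M / r by rewrite divr_ge0// ltW.
have le42 : 4^-1 <= 2^-1 :> R by lra.
have le82 : 8^-1 <= 2^-1 :> R by lra.
have ge4 : 0 <= 4^-1 :> R by lra.
have ge8 : 0 <= 8^-1 :> R by lra.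
have ge2 : 0 <= 2^-1 :> R by lra.
exists r, (M / r * 2 ^+ n); split.
- by rewrite r_gt0 /r ge_min lexx orbT.
- by move=> i N; exact: sum_dominated_le (D1 i) Mr.
- move=> i x xr.
  have /choice[D DE] : forall j, exists l,
      lim_to (fun N => ser (dcoef j a id) (dexpo j id) N x) l.
    by move=> j; exact: ser_exists ge4 le42 Mr (D1 j) (ltW xr).
  suff -> : partial i F x = D i by exact: DE.
  pose rho := (r - sup_norm x) / 2.
  have rho0 : 0 < rho by rewrite divr_gt0// subr_gt0.
  have delta1 : sup_norm (delta_mx 0 i : 'rV[R[i]]_n) <= 1.
    apply/sup_norm_leP => // j; rewrite mxE eqxx /=.
    by case: (_ == _); rewrite ?normc1 ?normc0.
  have xrho : sup_norm x + rho * sup_norm (delta_mx 0 i : 'rV[R[i]]_n) < r.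
    apply: (@le_lt_trans _ _ (sup_norm x + rho)).
      by rewrite lerD2l ler_piMr// ltW.
    by rewrite /rho; have := xr; lra.
  apply: (@partial_eq _ _ _ _ _ _ (M * 2 ^+ n / rho ^+ 2) rho) => // t trho.
  have FE' y : sup_norm y < r -> lim_to (fun N => ser a id N y) (F y).
    by move=> yr; apply: FE; apply: lt_le_trans yr (le_trans rr0 _); lra.
  have := @ser_line1 _ _ r _ a id F (fun N => sum_dominated_le N ge8 le82 D0 M0)
    FE' x (delta_mx 0 i) rho rho0 xrho D t DE (ltW trho).
  rewrite (bigD1 i)//= mxE !eqxx mul1r big1 ?addr0; last first.
    by move=> j /negbTE ji; rewrite mxE eqxx ji mul0r.
  by rewrite expr_div_n mulrA mulrAC.
- move=> i j x xr; apply: ser_exists ge2 (lexx _) _ (D2 i j) (ltW xr).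
  by rewrite divr_ge0// ltW.
Qed.

End analytic_partial.

Section weights.
Variables (R : realType) (n : nat) (w : 'I_n -> nat).
Hypothesis w_ge1 : forall i, (1 <= w i)%N.
Local Notation expo := {ffun 'I_n -> nat}.
Implicit Types (k E : expo) (x y : 'rV[R[i]]_n) (s : R).

Lemma min_weight_le i : (min_weight w <= w i)%N.
Proof.
rewrite /min_weight; move: (\max_(j < n) w j)%N => z; have := mem_index_enum i.
elim: (index_enum _) => // j l IH; rewrite inE big_cons geq_min.
by case/orP => [/eqP ->|/IH ->]; rewrite ?leqnn ?orbT.
Qed.

Lemma leq_weight i k : (w i * k i <= weight w k)%N.
Proof. by rewrite /weight (bigD1 i)//= leq_addr. Qed.

Lemma leq_expo_weight i k : (k i <= weight w k)%N.
Proof. by apply: leq_trans (leq_weight i k); rewrite leq_pmull. Qed.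

Lemma mdeg_le_weight k : (mdeg k <= weight w k)%N.
Proof. by apply: leq_sum => i _; rewrite leq_pmull. Qed.

Lemma weight_box k (N : nat) : (weight w k < N)%N -> k \in box n N.
Proof.
move=> kN; rewrite mem_box; apply/forallP => i.
exact: leq_ltn_trans (leq_expo_weight i k) kN.
Qed.

Lemma weight_mdec i k : (0 < k i)%N -> weight w k = (w i + weight w (mdec i k))%N.
Proof.
move=> ki; rewrite /weight (bigD1 i)//= [in RHS](bigD1 i)//= ffunE eqxx addnA.
rewrite -mulnS subn1 prednK//; congr addn; apply: eq_bigr => j /negbTE ji.
by rewrite ffunE ji subn0.
Qed.

Definition wscale s y : 'rV[R[i]]_n := \row_i ((s ^+ w i)%:C%C * y 0 i).

Lemma wscale_coord s y i : 0 <= s ->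
  normc (wscale s y 0 i) = s ^+ w i * normc (y 0 i).
Proof. by move=> s0; rewrite mxE normcM normc_real ger0_norm// exprn_ge0. Qed.

Lemma wscale_sup_norm s y m : 0 <= s <= 1 -> (forall i, (m <= w i)%N) ->
  sup_norm (wscale s y) <= s ^+ m * sup_norm y.
Proof.
move=> /andP[s0 s1] mw; apply/sup_norm_leP => [|i].
  by rewrite mulr_ge0 ?exprn_ge0 ?sup_norm_ge0.
rewrite wscale_coord// ler_pM ?exprn_ge0 ?normc_ge0 ?le_sup_norm//.
by rewrite ler_wiXn2l// mw.
Qed.

Lemma wscale0l y : wscale 0 y = 0.
Proof. by apply/rowP => i; rewrite !mxE expr0n gtn_eqF ?w_ge1// mul0r. Qed.

Lemma wscale0r s : wscale s 0 = 0.
Proof. by apply/rowP => i; rewrite !mxE mulr0. Qed.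

Lemma wscale_neq0 s y : s != 0 -> y != 0 -> wscale s y != 0.
Proof.
move=> s0; apply: contraNneq => /rowP sy; apply/eqP/rowP => i.
have /eqP := sy i; rewrite !mxE mulf_eq0 => /orP[|/eqP //].
by rewrite -normc_eq0 normc_real normr_eq0 expf_eq0 (negbTE s0) andbF.
Qed.

Lemma monomial_wscale s y E :
  monomial E (wscale s y) = (s ^+ weight w E)%:C%C * monomial E y.
Proof.
rewrite /monomial /weight -prodrXr rmorph_prod -big_split /=.
by apply: eq_bigr => i _; rewrite mxE exprMn exprM -rmorphXn.
Qed.

(* [s] is the quasi-norm [max_i |x_i|^(1/w_i)]. *)
Lemma weighted_polar (s1 : R) : (0 < n)%N -> 0 < s1 -> exists2 r : R, 0 < r &
  forall x, x != 0 -> sup_norm x < r -> exists s y,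
    [/\ 0 < s < s1, sup_norm y = 1 & x = wscale s y].
Proof.
move=> n0 s10; pose W := (\max_(i < n) w i)%N; pose s2 := Num.min s1 1.
have s20 : 0 < s2 by rewrite lt_min s10 ltr01.
(* As [s2 <= 1], the largest weight gives the smallest power, so [sup_norm x < s2 ^+ W] forces
   [s < s2]. *)
exists (s2 ^+ W); first by rewrite exprn_gt0.
move=> x x0 xr.
pose q i : R := normc (x 0 i) `^ (w i)%:R^-1.
have w0 i : (w i)%:R != 0 :> R by rewrite pnatr_eq0 -lt0n w_ge1.
have qE i : q i ^+ w i = normc (x 0 i).
  by rewrite -powR_mulrn ?powR_ge0// -powRrM mulVf// powRr1// normc_ge0.
have q0 i : 0 <= q i by exact: powR_ge0.
pose s := \big[Num.max/0]_(i < n) q i.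
have qs i : q i <= s by exact: (le_bigmax_cond _ q).
have [i1 si1] : exists i, s = q i.
  rewrite /s; case: (n) n0 q q0 {qE qs s} => // m _ q q0.
  by rewrite (@bigmax_eq_arg _ _ _ _ ord0)//; eexists.
have s0 : 0 < s.
  rewrite lt_neqAle si1 q0 andbT -si1; apply: contraNneq x0 => s0.
  apply/eqP/rowP => i; rewrite mxE; apply: eq0_normc; rewrite -qE.
  have -> : q i = 0 by apply/eqP; rewrite eq_le q0 s0 qs.
  by rewrite expr0n gtn_eqF ?w_ge1.
have ss1 : s < s1.
  apply: (@lt_le_trans _ _ s2); last by rewrite ge_min lexx.
  rewrite ltNge; apply/negP => s2s; have : sup_norm x < sup_norm x.
    apply: lt_le_trans xr _; apply: le_trans (le_sup_norm x i1).
    rewrite -qE -si1; apply: (@le_trans _ _ (s2 ^+ w i1)).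
      by rewrite ler_wiXn2l ?(ltW s20) ?ge_min ?lexx ?orbT// leq_bigmax.
    by rewrite lerXn2r ?nnegrE ?(ltW s20) ?(ltW s0).
  by rewrite ltxx.
have sw i : 0 < s ^+ w i by rewrite exprn_gt0.
exists s, (\row_i (x 0 i / (s ^+ w i)%:C%C)); split; first by rewrite s0.
  apply/eqP; rewrite eq_le; apply/andP; split.
    apply/sup_norm_leP => // i; rewrite mxE normcM normcV normc_real gtr0_norm//.
    by rewrite ler_pdivrMr// mul1r -qE lerXn2r ?nnegrE ?(ltW s0).
  apply: le_trans (le_sup_norm _ i1); rewrite mxE normcM normcV normc_real.
  by rewrite gtr0_norm// si1 qE divff// -qE -si1 gt_eqF.
apply/rowP => i; rewrite !mxE mulrC divfK//.
by rewrite -normc_eq0 normc_real normr_eq0 gt_eqF.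
Qed.

End weights.

Section principal_gradient.
Variables (R : realType) (n : nat) (w : 'I_n -> nat) (d : nat).
Hypothesis w_ge1 : forall i, (1 <= w i)%N.
Local Notation expo := {ffun 'I_n -> nat}.
Variable a : expo -> R[i].
Implicit Types (k : expo) (x y : 'rV[R[i]]_n) (s : R).

(* The partial derivatives of the principal part; every exponent of weight [d]
   has its coordinates at most [d], hence lies in the box. *)
Definition hcoef i k := if weight w k == d then dcoef i a id k else 0.
Definition hpart i y := ser (hcoef i) (dexpo i id) d.+1 y.

Lemma hpart_box i y N : (d < N)%N ->
  ser (hcoef i) (dexpo i id) N y = hpart i y.
Proof.
move=> dN; rewrite /hpart /ser (big_box_sub _ dN) [RHS]big_mkcond /=.
apply: eq_bigr => k _; case: ifP => //; rewrite /hcoef.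
case: eqP => [kd|_ _]; last by rewrite mul0r.
by rewrite (weight_box w_ge1)// kd.
Qed.

(** The truncated [d - w i] is harmless: if [w i > d], no exponent of weight [d] involves [x_i], and
    both sides vanish. *)
Lemma hpart_wscale i y s :
  hpart i (wscale w s y) = (s ^+ (d - w i))%:C%C * hpart i y.
Proof.
rewrite /hpart /ser big_distrr; apply: eq_bigr => k _ /=.
rewrite monomial_wscale // /hcoef; case: eqP => [kd|_]; last by rewrite !mul0r mulr0.
rewrite /dcoef /=; case: (posnP (k i)) => [->|ki]; first by rewrite mulr0 !mul0r mulr0.
by rewrite -kd (weight_mdec _ ki) addKn mulrCA.
Qed.

Lemma hpart_neq0_weight i y : hpart i y != 0 -> (w i <= d)%N.
Proof.
apply: contraNT; rewrite -ltnNge => dw; apply/eqP; apply: big1 => k _.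
rewrite /hcoef; case: eqP => [kd|_]; last by rewrite mul0r.
rewrite /dcoef /=; case: (posnP (k i)) => [->|ki]; first by rewrite mulr0 mul0r.
by move: dw; rewrite -kd (weight_mdec _ ki) ltnNge leq_addr.
Qed.

Lemma hpart_lipschitz : exists2 L : R, 0 < L & forall i y y',
  sup_norm y <= 2 -> sup_norm y' <= 2 ->
  normc (hpart i y - hpart i y') <= L * sup_norm (y - y').
Proof.
(* [6 = 2 + 4]: the base point has norm at most 2, and the line is followed over length 4, which
   bounds [|y - y'|]. Radius 2 in the statement leaves room around the unit sphere. *)
pose Bh i : R := \sum_(k <- box n d.+1) normc (hcoef i k) * 6 ^+ mdeg (dexpo i id k).
have Bh0 i : 0 <= Bh i.
  by apply: sumr_ge0 => k _; rewrite mulr_ge0 ?normc_ge0 ?exprn_ge0.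
exists (1 + \sum_i Bh i) => [|i y y' y2 y'2].
  by rewrite ltr_wpDr// sumr_ge0.
have [yy|yy0] := eqVneq (sup_norm (y - y')) 0.
  have /eqP := sup_norm_eq0 yy; rewrite subr_eq0 => /eqP ->.
  by rewrite !subrr normc0 sup_norm0 mulr0.
have yy : 0 < sup_norm (y - y') by rewrite lt_neqAle eq_sym yy0 sup_norm_ge0.
have yy4 : sup_norm (y - y') <= 4.
  rewrite (le_trans (sup_normD _ _))// -[- y']scaleN1r.
  rewrite (_ : 4 = 2 + 2); last by ring.
  rewrite lerD// (le_trans (sup_normZ _ _))//.
  by rewrite normcN normc1 mul1r.
pose rho := 4 / sup_norm (y - y').
have rho0 : 0 < rho by rewrite divr_gt0.
have cn : coef_norm_le rho (ser_poly (hcoef i) (dexpo i id) d.+1 y' (y - y')) (Bh i).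
  apply: (@ser_poly_norm _ _ _ _ _ _ _ _ 6) => //; first exact: ltW.
  by rewrite /rho divfK//; move: y'2; lra.
have := @coef_norm_taylor _ _ _ _ 1 1 rho0 cn.
rewrite normc1 ler_pdivlMr// mul1r => /(_ yy4).
rewrite horner_ser_poly big_ord_recl big_ord0 addr0 ser_poly_coef0 mulr1.
rewrite scale1r [y' + _]addrC subrK expr1 => /le_trans; apply.
rewrite /rho div1r invf_div mulrA mulrAC ler_wpM2r ?sup_norm_ge0//.
apply: (@le_trans _ _ (Bh i)); first by rewrite ler_piMr ?Bh0//; lra.
by rewrite (bigD1 i)//= addrCA lerDl addr_ge0// sumr_ge0.
Qed.

Section estimate.
Variables (F : 'rV[R[i]]_n -> R[i]) (r B : R).
Hypothesis ad : forall k, (weight w k < d)%N -> a k = 0.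
Hypothesis r01 : 0 < r <= 1.
Hypothesis bB : forall i N, \sum_(k <- box n N) normc (dcoef i a id k) *
                    r ^+ mdeg (dexpo i id k) <= B.
Hypothesis FE : forall i x, sup_norm x < r ->
  lim_to (fun N => ser (dcoef i a id) (dexpo i id) N x) (partial i F x).

(** Terms of weight below [d] vanish and those of weight [d] cancel; the others carry at least
    [s ^+ (d.+1 - w i)]. Writing [s = (s/r) r] factors this power out, and [r <= 1] gives
    [r ^ weight <= r ^ mdeg], so what remains is bounded by [B]. *)
Lemma partial_hpart_le i s y : 0 <= s < r -> sup_norm y <= 1 ->
  normc (partial i F (wscale w s y) - hpart i (wscale w s y)) <=
    B / r ^+ d.+1 * s ^+ (d.+1 - w i).
Proof.
move=> /andP[s0 sr] y1; have /andP[r0 r1] := r01.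
have s1 : s <= 1 by exact: le_trans (ltW sr) r1.
have B0 : 0 <= B.
  by have := bB i 0; apply: le_trans; apply: sumr_ge0 => k _;
    rewrite mulr_ge0 ?normc_ge0 ?exprn_ge0 ?(ltW r0).
have sr0 : 0 <= s / r by rewrite divr_ge0// ltW.
have sr1 : s / r <= 1 by rewrite ler_pdivrMr// mul1r ltW.
set x := wscale w s y.
have xr : sup_norm x < r.
  apply: le_lt_trans sr; rewrite (le_trans (wscale_sup_norm (m := 1) _ _ _)) ?s0//.
  by rewrite expr1 ler_piMr.
apply: (@lim_to_dist_le _ _ _ _ _ d.+1 (FE i xr)) => N dN.
rewrite -(hpart_box i x dN) -sumrB.
apply: le_trans (le_normc_sum _ _ _) _.
(* Replacing [r ^+ (d.+1 - w i)] by the smaller [r ^+ d.+1] makes the constant independent of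
   [i]. *)
apply: (@le_trans _ _ ((s / r) ^+ (d.+1 - w i) * B)); last first.
  rewrite mulrC -mulrA ler_wpM2l// expr_div_n mulrC ler_wpM2r ?exprn_ge0//.
  by rewrite lef_pV2 ?posrE ?exprn_gt0// ler_wiXn2l ?(ltW r0)// leq_subr.
apply: (le_trans _ (ler_wpM2l (exprn_ge0 (d.+1 - w i) sr0) (bB i N))).
rewrite big_distrr /=.
apply: ler_sum => k _; have RHS0 : 0 <= (s / r) ^+ (d.+1 - w i) *
    (normc (dcoef i a id k) * r ^+ mdeg (dexpo i id k)).
  by rewrite !mulr_ge0 ?exprn_ge0 ?normc_ge0// ltW.
rewrite /hcoef; case: (ltngtP (weight w k) d) => kd.
- have -> : dcoef i a id k = 0 by rewrite /dcoef ad// mul0r.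
  by rewrite mul0r subrr normc0 mul0r mulr0.
- rewrite mul0r subr0 normcM.
  case: (posnP (k i)) => [ki|ki].
    by rewrite /dcoef /= ki mulr0 normc0 !mul0r mulr0.
  rewrite [leRHS]mulrCA ler_wpM2l ?normc_ge0//.
  rewrite monomial_wscale // normcM normc_real ger0_norm ?exprn_ge0//.
  have wk := weight_mdec w ki.
  apply: (@le_trans _ _ (s ^+ weight w (mdec i k))).
    by rewrite ler_piMr ?exprn_ge0// (le_trans (normc_monomial_le _ y1))//.
  rewrite -{1}(divfK (lt0r_neq0 r0) s) exprMn ler_pM ?exprn_ge0 ?(ltW r0)//.
    by rewrite ler_wiXn2l// leq_subLR -wk.
  by rewrite ler_wiXn2l ?(ltW r0)// mdeg_le_weight.
- by rewrite subrr normc0.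
Qed.

End estimate.
End principal_gradient.

(** * The Lojasiewicz exponent *)

Section euclidean.
Variables (R : realType) (n : nat).
Implicit Types x : 'rV[R[i]]_n.

Lemma le_euclidean_norm x : sup_norm x <= euclidean_norm x.
Proof.
apply/sup_norm_leP => [|i]; first exact: sqrtr_ge0.
rewrite -[leLHS]ger0_norm ?normc_ge0// -sqrtr_sqr ler_wsqrtr//.
by rewrite (bigD1 i)//= lerDl sumr_ge0// => j _; exact: sqr_ge0.
Qed.

Lemma euclidean_norm_le x : euclidean_norm x <= n%:R * sup_norm x.
Proof.
rewrite -[leRHS]ger0_norm ?mulr_ge0 ?sup_norm_ge0// -sqrtr_sqr ler_wsqrtr//.
apply: le_trans (norm2_le (lexx (sup_norm x))) _.
rewrite exprMn ler_wpM2r ?sqr_ge0// -natrX ler_nat.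
by case: (n) => // m; rewrite leq_pmulr.
Qed.

End euclidean.

Section exponent.
Variables (R : realType) (n : nat) (w : 'I_n -> nat) (d : nat).
Hypothesis w_ge1 : forall i, (1 <= w i)%N.
Local Notation expo := {ffun 'I_n -> nat}.
Variables (a : expo -> R[i]) (F : 'rV[R[i]]_n -> R[i]) (r0 M : R).
Hypothesis Fs : has_series F a r0 M.
Hypothesis ad : forall k, (weight w k < d)%N -> a k = 0.
Local Notation H := (hpart w d a).
Hypothesis H_iso : forall y, y != 0 -> exists i, H i y != 0.
Hypothesis H_0 : forall i, H i 0 = 0.
Variable i0 : 'I_n.
Hypothesis i0A : i0 \in min_weight_set w.
Hypothesis H_A : forall y, sup_norm y <= 1 ->
  (forall i, i \in min_weight_set w -> y 0 i = 0) -> H i0 y = 0.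
Implicit Types (k : expo) (x y : 'rV[R[i]]_n) (s : R).

Local Notation w0 := (min_weight w).

Let n_gt0 : (0 < n)%N.
Proof. exact: leq_ltn_trans (leq0n _) (ltn_ord i0). Qed.

Let w_i0 : w i0 = w0.
Proof. by move: i0A; rewrite inE => /eqP. Qed.

Let delta_neq0 i : (delta_mx 0 i : 'rV[R[i]]_n) != 0.
Proof.
apply/eqP => /rowP/(_ i); rewrite !mxE !eqxx => /eqP.
by rewrite oner_eq0.
Qed.

(** Otherwise no monomial of weight [d] involves [x_i], and the gradient of [h] on the [i]-th axis
    would keep its value 0 at the origin. *)
Lemma weight_le_degree i : (w i <= d)%N.
Proof.
rewrite leqNgt; apply/negP => dw; have [j] := H_iso (delta_neq0 i).
rewrite -(H_0 j); apply/negP; rewrite negbK; apply/eqP.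
apply: eq_bigr => k _; rewrite /hcoef; case: eqP => [kd|_]; last by rewrite !mul0r.
congr (_ * _); apply: eq_bigr => l _; rewrite !mxE eqxx /=.
case: eqP => // ->; rewrite ffunE (_ : k i = 0)%N ?sub0n ?expr0//.
apply/eqP; rewrite -leqn0 leqNgt; apply/negP => ki.
by move: dw; rewrite -kd (weight_mdec _ ki) ltnNge leq_addr.
Qed.

(** Otherwise all weights equal [d] and every partial of [h] has degree 0; scaling by 0, with
    [0 ^ 0 = 1], equates its values with that at the origin. *)
Lemma min_weight_lt_degree : (w0 < d)%N.
Proof.
rewrite ltnNge; apply/negP => dw; have [i ] := H_iso (delta_neq0 i0).
apply/negP; rewrite negbK; apply/eqP.
have wd : w i = d.
  by apply/eqP; rewrite eqn_leq weight_le_degree (leq_trans dw)// min_weight_le.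
have := hpart_wscale w d a i (delta_mx 0 i0) 0.
by rewrite wscale0l// H_0 wd subnn expr0 mul1r => <-.
Qed.

Let alpha0 : R := (d%:R - w0%:R) / w0%:R.

Let w0_gt0 : 0 < w0%:R :> R.
Proof. by rewrite ltr0n -w_i0. Qed.

Let alpha0_gt0 : 0 < alpha0.
Proof. by rewrite divr_gt0// subr_gt0 ltr_nat min_weight_lt_degree. Qed.

Let powR_alpha0 s : 0 <= s -> (s ^+ w0) `^ alpha0 = s ^+ (d - w0).
Proof.
move=> s0; rewrite -powR_mulrn// -powRrM /alpha0 mulrC divfK ?lt0r_neq0//.
by rewrite -natrB ?powR_mulrn// ltnW// min_weight_lt_degree.
Qed.

Lemma hpart_sphere_lower : exists2 c : R, 0 < c &
  forall y, sup_norm y = 1 -> exists i, c <= normc (H i y).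
Proof.
have [L L0 HL] := hpart_lipschitz w d a.
pose S y := \sum_i normc (H i y) ^+ 2.
have [||y1] := @sup_norm_EVT R n 1 1 S.
- exists (const_mx 1); have [//|i ->] := @sup_norm_attained R n (const_mx 1).
  by rewrite mxE normc1 lexx.
- move=> x; rewrite -eq_le => /eqP x1.
  apply: (@continuous_sum_sq _ _ _ predT H _ L 1) => // i y _ yx1.
  apply: HL; last by rewrite -x1; lra.
  by rewrite -(subrK x y) (le_trans (sup_normD _ _))// -x1; move: yx1; lra.
rewrite -eq_le => /eqP y11 y1min.
have y10 : y1 != 0.
  by apply: contra_eq_neq y11 => ->; rewrite sup_norm0 oner_eq0.
have m0 : 0 < S y1.
  have [i Hi] := H_iso y10; rewrite /S (bigD1 i)//= ltr_pwDl//.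
    by rewrite exprn_gt0// normc_gt0.
  by apply: sumr_ge0 => j _; exact: sqr_ge0.
have nR : 0 < n%:R :> R by rewrite ltr0n.
(* Some square among the [n] is at least the average, and the sum is at least its minimum [S y1]. *)
exists (Num.sqrt (S y1 / n%:R)) => [|y yn1].
  by rewrite sqrtr_gt0 divr_gt0.
apply: contrapT => noi.
have : S y < S y1; last by apply/negP; rewrite -leNgt y1min// yn1 lexx.
have -> : S y1 = \sum_(i < n) (S y1 / n%:R).
  by rewrite sumr_const card_ord -[RHS]mulr_natr divfK// lt0r_neq0.
apply: ltr_sum => [|i _]; first by apply/hasP; exists i0; rewrite ?mem_index_enum.
rewrite -[ltRHS]sqr_sqrtr ?divr_ge0 ?(ltW m0)//.
rewrite ltrXn2r ?normc_ge0 ?sqrtr_ge0//= ltNge; apply/negP => h.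
by apply: noi; exists i.
Qed.

Lemma lojasiewicz_exponent_gradient :
  lojasiewicz_exponent (gradient F) = alpha0%:E.
Proof.
have [r [B [r01 bB FE dFE]]] := analytic_partial Fs.
have /andP[r_gt0 r_le1] := r01.
have est := partial_hpart_le w_ge1 ad r01 bB FE.
set C := B / r ^+ d.+1 in est.
have [L L0 HL] := hpart_lipschitz w d a.
have [c c0 Hc] := hpart_sphere_lower.
have C0 : 0 <= C.
  rewrite divr_ge0 ?exprn_ge0 ?(ltW r_gt0)//.
  by have := bB i0 0; apply: le_trans; apply: sumr_ge0 => k _;
    rewrite mulr_ge0 ?normc_ge0 ?exprn_ge0 ?(ltW r_gt0).
have normH i s y : 0 <= s -> normc (H i (wscale w s y)) = s ^+ (d - w i) * normc (H i y).
  by move=> s0; rewrite hpart_wscale// normcM normc_real ger0_norm// exprn_ge0.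
have {}est i s y : 0 <= s < r -> sup_norm y <= 1 ->
    normc (partial i F (wscale w s y) - H i (wscale w s y)) <= C * s * s ^+ (d - w i).
  move=> sr y1; apply: le_trans (est i s y sr y1) _.
  by rewrite subSn ?weight_le_degree// exprS mulrA.
(* At [y = 0] scaling does not move the point, so a constant is bounded by [C * s] for all small
   [s]. *)
have F0 i : partial i F 0 = 0.
  apply: eq0_normc; apply/eqP; rewrite eq_le normc_ge0 andbT.
  apply: (@le0_of_small_le _ _ C (r / 2)); first by rewrite divr_gt0.
  move=> s s0 sr s1; have e := est i s 0.
  rewrite wscale0r sup_norm0 H_0 subr0 in e.
  apply: le_trans (e _ _) _ => //; first by apply/andP; split; lra.
  by apply: ler_piMr; [apply: mulr_ge0 => //|apply: exprn_ile1 => //]; exact: ltW.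
(* Below [s1] the error [C * s] stays under half of the lower bound [c]. *)
pose s1 := Num.min (r / 2) (c / (2 * (C + 1))).
have C1 : 0 < C + 1 by rewrite ltr_wpDl.
have s10 : 0 < s1 by rewrite lt_min !divr_gt0// mulr_gt0.
have s1r : s1 < r by rewrite /s1 gt_min; apply/orP; left; lra.
have Cs1 s : s < s1 -> 0 <= s -> C * s < c / 2.
  move=> ss1 s0; apply: (@le_lt_trans _ _ ((C + 1) * s)).
    by rewrite ler_wpM2r// lerDl.
  have -> : c / 2 = (C + 1) * (c / (2 * (C + 1))).
    by field; rewrite gt_eqF.
  by rewrite ltr_pM2l// (lt_le_trans ss1)// ge_min lexx orbT.
have [r1 r10 polar] := weighted_polar w_ge1 n_gt0 s10.
have grad_ge i x : normc (partial i F x) <= sup_norm (gradient F x).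
  by have := le_sup_norm (gradient F x) i; rewrite mxE.
apply/eqP; rewrite eq_le; apply/andP; split.
  apply: ereal_inf_lbound => /=; exists alpha0 => //; split => //.
  (* The first factor pays for [euclidean_norm x <= n * sup_norm x], the second inverts the lower
     bound [c / 2]. *)
  exists (n%:R `^ alpha0 * (2 / c)).
    by rewrite mulr_gt0 ?powR_gt0 ?ltr0n// divr_gt0.
  apply/nbhs_sup_normP; exists r1 => // x; rewrite subr0 => xr1.
  have [->|x0] := eqVneq x 0.
    rewrite /euclidean_norm big1 ?sqrtr0 ?powR0 ?gt_eqF//.
      apply: mulr_ge0; last exact: sup_norm_ge0.
      by rewrite mulr_ge0 ?powR_ge0// divr_ge0// ltW.
    by move=> i _; rewrite mxE normc0 expr0n.
  have [s [y [/andP[s0 ss1] y1 xE]]] := polar x x0 xr1.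
  have sr : 0 <= s < r by rewrite ltW//= (lt_trans ss1).
  have sle1 : s <= 1 by rewrite (le_trans _ r_le1)// ltW// (lt_trans ss1).
  have [i ci] := Hc _ y1.
  have h1 : c / 2 * s ^+ (d - w i) <= normc (partial i F x).
    have := est i s y sr; rewrite y1 lexx => /(_ isT); rewrite -xE => e1.
    have := le_normcB (H i x) (partial i F x); rewrite normc_distC => e2.
    have : normc (H i x) = s ^+ (d - w i) * normc (H i y).
      by rewrite xE normH// ltW.
    have sp : 0 < s ^+ (d - w i) by rewrite exprn_gt0.
    have e3 : s ^+ (d - w i) * c <= s ^+ (d - w i) * normc (H i y).
      by rewrite ler_pM2l.
    have e4 : C * s * s ^+ (d - w i) <= c / 2 * s ^+ (d - w i).
      by rewrite ler_pM2r// ltW// Cs1// ltW.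
    by move: e1 e2 e3 e4; lra.
  have h2 : c / 2 * s ^+ (d - w0) <= sup_norm (gradient F x).
    apply: le_trans (le_trans h1 (grad_ge i x)); rewrite ler_wpM2l//.
      by rewrite divr_ge0// ltW.
    by rewrite ler_wiXn2l ?(ltW s0)// leq_sub2l// min_weight_le.
  have h3 : euclidean_norm x <= n%:R * s ^+ w0.
    apply: le_trans (euclidean_norm_le x) _; rewrite ler_wpM2l// xE.
    have := @wscale_sup_norm R n w s y w0; rewrite y1 mulr1; apply.
      by rewrite ltW.
    exact: min_weight_le.
  apply: (@le_trans _ _ (n%:R `^ alpha0 * s ^+ (d - w0))).
    rewrite -powR_alpha0 ?(ltW s0)// -powRM ?exprn_ge0 ?(ltW s0)//.
    apply: ge0_ler_powR h3; rewrite ?nnegrE ?(ltW alpha0_gt0)//.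
      exact: sqrtr_ge0.
    by rewrite mulr_ge0 ?exprn_ge0 ?(ltW s0).
  rewrite -mulrA ler_wpM2l ?powR_ge0//.
  by rewrite mulrAC ler_pdivlMr// mulrC -ler_pdivrMl// mulrA [_^-1 * _]mulrC.
apply: le_ereal_inf_tmp => _ [al [al0 [c' c'0 /nbhs_sup_normP[r2 r20 adm]]] <-].
rewrite lee_fin leNgt; apply/negP => alalpha.
(* An admissible [al < alpha0] will give [rr ^ al <= K rr ^ alpha0] on every small sphere of radius
   [rr], that is [1 <= K t] for [t = rr ^ be]. In [K], [L + C] bounds the gradient and [L / c]
   compares [s ^+ w0] with [rr]. *)
pose be := alpha0 - al; have be0 : 0 < be by rewrite subr_gt0.
pose K := c' * (L + C) * (L / c) `^ alpha0.
pose r3 := Num.min r (Num.min r1 r2) / 2.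
have min0 : 0 < Num.min r (Num.min r1 r2) by rewrite !lt_min r_gt0 r10.
have r30 : 0 < r3 by rewrite divr_gt0.
have : 1 <= 0 :> R; last by rewrite ler10.
apply: (@le0_of_small_le _ _ K (r3 `^ be)); first exact: powR_gt0.
move=> t t0 tr3 t1; pose rr := t `^ be^-1.
have rr0 : 0 < rr by exact: powR_gt0.
have rrbe : rr `^ be = t by rewrite -powRrM mulVf ?gt_eqF// powRr1// ltW.
have rrr3 : rr <= r3.
  have -> : r3 = (r3 `^ be) `^ be^-1.
    by rewrite -powRrM mulfV ?gt_eqF// powRr1// ltW.
  by rewrite ge0_ler_powR ?nnegrE ?invr_ge0 ?powR_ge0// ltW.
have rrmin : rr < Num.min r (Num.min r1 r2).
  by apply: le_lt_trans rrr3 _; rewrite /r3; move: min0; lra.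
have /andP[rrr /andP[rrr1 rrr2]] : [&& rr < r, rr < r1 & rr < r2].
  by move: rrmin; rewrite !lt_min.
have [x xrr xz] := @common_zero_on_sphere R n i0 r B (fun i => dcoef i a id)
  (fun i => dexpo i id) (fun i => partial i F) bB FE dFE (fun i _ => F0 i) rr rr0 rrr.
have x0 : x != 0.
  by apply: contra_eq_neq xrr => ->; rewrite sup_norm0 lt_eqF.
have [|s [y [/andP[s0 ss1] y1 xE]]] := polar x x0; first by rewrite xrr.
have sr : 0 <= s < r by rewrite ltW//= (lt_trans ss1).
have sle1 : s <= 1 by rewrite (le_trans _ r_le1)// ltW// (lt_trans ss1).
have Hsmall i : i != i0 -> normc (H i y) < c.
  move=> ii0; have := est i s y sr; rewrite y1 lexx -xE xz// sub0r normcN.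
  rewrite xE normH ?(ltW s0)// [C * s * _]mulrC ler_pM2l ?exprn_gt0//.
  move=> /(_ isT) h; apply: le_lt_trans h _.
  by apply: lt_trans (Cs1 s ss1 (ltW s0)) _; lra.
have ci0 : c <= normc (H i0 y).
  have [i ci] := Hc _ y1; have [<-//|/Hsmall] := eqVneq i i0.
  by rewrite ltNge ci.
(* [H i0] vanishes at this projection, so the Lipschitz bound gives [c <= L |y - y'|]; the
   difference has only coordinates in [A_w], one of which is therefore at least [c / L]. *)
pose y' := \row_i (if i \in min_weight_set w then 0 else y 0 i).
have y'1 : sup_norm y' <= 1.
  apply/sup_norm_leP => // i; rewrite mxE; case: ifP; rewrite ?normc0// => _.
  by rewrite -y1 le_sup_norm.
have Hy' : H i0 y' = 0 by apply: H_A => // i iA; rewrite mxE iA.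
have := HL i0 y y'; rewrite y1 ler1n (le_trans y'1) ?ler1n// Hy' subr0 => /(_ isT isT).
have [l ->] := @sup_norm_attained R n (y - y') n_gt0.
move=> /(le_trans ci0); rewrite !mxE; case: ifP => [lA|_]; last first.
  by rewrite subrr normc0 mulr0 leNgt c0.
rewrite subr0 => cl.
have wl : w l = w0 by move: lA; rewrite inE => /eqP.
have sw0 : s ^+ w0 <= L / c * rr.
  rewrite mulrAC ler_pdivlMr//; apply: le_trans (ler_wpM2l (exprn_ge0 _ (ltW s0)) cl) _.
  rewrite mulrCA ler_pM2l// -xrr xE -wl -wscale_coord ?(ltW s0)//.
  exact: le_sup_norm.
have gle : sup_norm (gradient F x) <= (L + C) * s ^+ (d - w0).
  apply/sup_norm_leP => [|i].
    by rewrite mulr_ge0 ?exprn_ge0 ?addr_ge0 ?(ltW s0) ?(ltW L0).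
  rewrite mxE; have [->|ii0] := eqVneq i i0; last first.
    by rewrite xz// normc0 mulr_ge0 ?exprn_ge0 ?addr_ge0 ?(ltW s0) ?(ltW L0).
  rewrite -(subrK (H i0 x) (partial i0 F x)) (le_trans (le_normcD _ _))//.
  have := est i0 s y sr; rewrite y1 lexx -xE w_i0 => /(_ isT) e1.
  have e2 : normc (H i0 x) <= L * s ^+ (d - w0).
    rewrite xE normH ?(ltW s0)// w_i0 mulrC ler_wpM2r ?exprn_ge0 ?(ltW s0)//.
    by have := HL i0 y 0; rewrite y1 sup_norm0 H_0 !subr0 y1 mulr1 ler1n; apply.
  have e3 : C * s * s ^+ (d - w0) <= C * s ^+ (d - w0).
    by rewrite ler_wpM2r ?exprn_ge0 ?(ltW s0)// ler_piMr.
  by move: e1 e2 e3; lra.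
have key : rr `^ al <= K * rr `^ alpha0.
  apply: (@le_trans _ _ (euclidean_norm x `^ al)).
    apply: ge0_ler_powR; rewrite ?nnegrE ?(ltW al0) ?(ltW rr0) ?sqrtr_ge0//.
    by rewrite -xrr le_euclidean_norm.
  apply: le_trans (adm x _) _; first by rewrite subr0 xrr.
  rewrite /K -!mulrA ler_pM2l// -powRM ?divr_ge0 ?(ltW L0) ?(ltW c0) ?(ltW rr0)//.
  apply: le_trans gle _; rewrite ler_wpM2l ?addr_ge0 ?(ltW L0)//.
  rewrite -powR_alpha0 ?(ltW s0)//; apply: ge0_ler_powR => //.
  - exact: ltW.
  - by rewrite nnegrE exprn_ge0// ltW.
  - by rewrite nnegrE mulr_ge0 ?divr_ge0 ?(ltW L0) ?(ltW c0) ?(ltW rr0).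
rewrite -rrbe /be powRB; last by rewrite gt_eqF ?implybT.
by rewrite mulrA ler_pdivlMr ?powR_gt0// mul1r.
Qed.

End exponent.

(** * From unconditional summability to coefficient bounds and box sums *)

Section expansion.
Variables (R : realType) (n : nat).
Local Notation expo := {ffun 'I_n -> nat}.
Implicit Types (x : 'rV[R[i]]_n) (f : 'rV[R[i]]_n -> R[i]) (a : expo -> R[i]).

Lemma fset_sub_box (A : {fset expo}) : exists N, {subset A <= box n N}.
Proof.
exists (\max_(k <- A) \max_(i < n) k i).+1%N => k kA.
rewrite mem_box; apply/forallP => i; rewrite ltnS.
by rewrite (big_rem k)//= leq_max (leq_bigmax (F := fun i => k i) i).
Qed.

Lemma partial_sum_box (c : expo -> R[i]) N :
  summability.partial_sum c [fset k in box n N]%fset = \sum_(k <- box n N) c k.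
Proof.
rewrite /summability.partial_sum -(big_seq_fsetE _ _ xpredT).
apply: perm_big; apply: uniq_perm; rewrite ?fset_uniq ?box_uniq//.
by move=> k; rewrite !inE.
Qed.

Lemma totally_cvgP (c : expo -> R[i]) (l : R[i]) :
  summability.partial_sum c @ summability.totally --> l ->
  forall e : R, 0 < e -> exists A0 : {fset expo}, forall A : {fset expo},
    (A0 `<=` A)%fset -> normc (l - summability.partial_sum c A) < e.
Proof.
have FF := @summability.totally_filter expo.
move=> /cvgrPdist_lt cl e e0; have := cl e%:C%C; rewrite ltcR => /(_ e0)[A0 _ h].
by exists A0 => A /h hA; rewrite -ltcR; exact: hA.
Qed.

(** A term outside [A0] is the difference of two partial sums within 1 of the limit; the finitely
    many others are bounded by their sum. *)
Lemma totally_bounded (c : expo -> R[i]) (l : R[i]) :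
  summability.partial_sum c @ summability.totally --> l ->
  exists M : R, forall k, normc (c k) <= M.
Proof.
move=> /totally_cvgP /(_ 1 ltr01)[A0 h].
exists (2 + \sum_(k <- A0) normc (c k)) => k.
have S0 (s : seq expo) : 0 <= \sum_(k <- s) normc (c k).
  by apply: sumr_ge0 => *; exact: normc_ge0.
have [kA|kA] := boolP (k \in A0).
  by rewrite (big_rem k)//= addrCA lerDl addr_ge0.
apply: (@le_trans _ _ 2); last by rewrite lerDl.
have -> : c k = (l - summability.partial_sum c A0) -
    (l - summability.partial_sum c (k |` A0)%fset).
  rewrite /summability.partial_sum -!(big_seq_fsetE _ _ xpredT) /=.
  by rewrite big_fsetU1//=; ring.
rewrite (le_trans (le_normcD _ _))// normcN ltW// (_ : 2 = 1 + 1)//.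
by rewrite ltrD// h// ?fsubset_refl// fsubsetUr.
Qed.

Lemma power_expansion_series f a : power_expansion f a ->
  exists r M, has_series f a r M.
Proof.
move=> /nbhs_sup_normP[r1 r10 fa]; pose r := r1 / 2.
have r0 : 0 < r by rewrite divr_gt0.
have rr1 : r < r1 by rewrite /r; lra.
(* At the diagonal point every monomial has modulus exactly [r ^+ mdeg k]. *)
have [|M aM] := @totally_bounded (fun k => a k * monomial k (const_mx r%:C%C))
    (f (const_mx r%:C%C)).
  apply: fa; rewrite subr0; apply/sup_norm_ltP => // i.
  by rewrite mxE normc_real gtr0_norm.
exists r, M; split => // [k|x xr].
  apply: le_trans (aM k); rewrite normcM ler_wpM2l ?normc_ge0//.
  rewrite normc_prod /mdeg -prodrXr le_eqVlt; apply/orP; left; apply/eqP.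
  by apply: eq_bigr => i _; rewrite mxE normcX normc_real gtr0_norm.
move=> e e0; have := fa x; rewrite subr0 => /(_ (lt_trans xr rr1)).
move=> /totally_cvgP/(_ e e0)[A0 h]; have [N A0N] := fset_sub_box A0.
exists N => m Nm; rewrite normc_distC /ser -(partial_sum_box (fun k => a k * monomial k x)).
apply: h.
by apply/fsubsetP => k /A0N kN; rewrite inE /=; exact: sub_box Nm _ kN.
Qed.

End expansion.

(** * The principal part and the vanishing of its partial derivatives *)

Section principal.
Variables (R : realType) (n : nat) (w : 'I_n -> nat).
Hypothesis w_ge1 : forall i, (1 <= w i)%N.
Local Notation expo := {ffun 'I_n -> nat}.
Variable f : 'rV[R[i]]_n -> R[i].
Local Notation a := (taylor_coef f).
Local Notation d := (weighted_order w f).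
Local Notation h := (principal_part w f).
Variables (r0 M : R).
Hypothesis fs : has_series f a r0 M.
Implicit Types (k : expo) (x y : 'rV[R[i]]_n) (s : R).

Lemma taylor_coef_weight_lt k : (weight w k < d)%N -> a k = 0.
Proof.
(* In the default case the order is 0, and no weight is smaller. *)
rewrite /weighted_order; case: xgetP => [_ -> [_ dmin]|//] kd.
apply: contrapT => /eqP ak; have := dmin k ak.
by rewrite leqNgt kd.
Qed.

(** [lojasiewicz_exponent_gradient] accepts any expansion, so these coefficients serve for [h] in
    place of [taylor_coef h]. *)
Definition principal_coef k := if weight w k == d then a k else 0.

Lemma principal_part_ser x N : (d < N)%N -> ser principal_coef id N x = h x.
Proof.
move=> dN; rewrite /principal_part.
rewrite (fsbig_fwiden [seq k <- box n N | weight w k == d]).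
- rewrite big_filter [RHS]big_mkcond; apply: eq_bigr => k _.
  by rewrite /principal_coef; case: ifP; rewrite ?mul0r.
- by move=> k [_ kd] /=; rewrite mem_filter kd eqxx (weight_box w_ge1)// kd.
- by rewrite filter_uniq// box_uniq.
- move=> k [] /=; rewrite mem_filter => /andP[/eqP kd _] nsupp.
  have [-> |ak] := eqVneq (a k) 0; first by rewrite mul0r.
  by case: nsupp.
Qed.

Lemma principal_part_series : has_series h principal_coef r0 M.
Proof.
have [r00 aM _] := fs; split => // [k|x _].
  rewrite /principal_coef; case: ifP => // _; rewrite normc0 mul0r.
  by apply: le_trans (aM k); rewrite mulr_ge0 ?normc_ge0 ?exprn_ge0 ?(ltW r00).
apply: (@lim_to_ext _ (fun=> h x) _ _ d.+1 _ (lim_to_cst _)) => N dN.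
by rewrite principal_part_ser.
Qed.

Lemma hpart_principal_coef : hpart w d principal_coef = hpart w d a.
Proof.
apply/funext => i; apply/funext => y; apply: eq_bigr => k _.
by rewrite /hcoef /dcoef /principal_coef; case: (weight w k == d).
Qed.

Lemma partial_principal_part : exists2 r : R, 0 < r &
  forall i x, sup_norm x < r -> partial i h x = hpart w d a i x.
Proof.
have [r [B [/andP[r_gt0 _] _ hE _]]] := analytic_partial principal_part_series.
exists r => // i x xr; apply: lim_to_unique (hE i x xr) _.
apply: (@lim_to_ext _ (fun=> hpart w d a i x) _ _ d.+1 _ (lim_to_cst _)) => N dN.
rewrite -(hpart_box w_ge1 _ _ _ dN); apply: eq_bigr => k _.
rewrite /hcoef /dcoef /principal_coef.
by case: (weight w k == d); rewrite ?mul0r.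
Qed.

Hypothesis h_iso : isolated_singularity h.

Lemma hpart0 i : hpart w d a i 0 = 0.
Proof.
have [r r_gt0 hE] := partial_principal_part.
have [r2 r20 iso] := (nbhs_sup_normP _ _).1 h_iso.
have /rowP/(_ i) : gradient h 0 = 0 by apply/iso; rewrite ?subr0 ?sup_norm0.
by rewrite !mxE hE// sup_norm0.
Qed.

(** The singularity is isolated only near 0; scaling brings any [y] there and multiplies each
    partial by a power of [s]. *)
Lemma hpart_isolated y : y != 0 -> exists i, hpart w d a i y != 0.
Proof.
move=> y0; have [r r_gt0 hE] := partial_principal_part.
have [r2 r20 iso] := (nbhs_sup_normP _ _).1 h_iso.
pose r3 := Num.min r r2; have r30 : 0 < r3 by rewrite lt_min r_gt0.
have Y0 : 0 < sup_norm y + 1 by rewrite ltr_wpDl// sup_norm_ge0.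
pose s := Num.min 1 (r3 / (sup_norm y + 1)).
have s0 : 0 < s by rewrite lt_min ltr01 divr_gt0.
have xr3 : sup_norm (wscale w s y) < r3.
  apply: le_lt_trans (wscale_sup_norm (m := 1) _ _ _) _ => //.
    by rewrite ltW//= ge_min lexx.
  rewrite expr1; apply: (@le_lt_trans _ _ (r3 / (sup_norm y + 1) * sup_norm y)).
    by rewrite ler_wpM2r ?sup_norm_ge0// ge_min lexx orbT.
  by rewrite mulrAC ltr_pdivrMr// ltr_pM2l// ltrDl.
move: xr3; rewrite lt_min => /andP[xr xr2].
apply: contrapT => noi.
have : wscale w s y = 0; last first.
  by apply/eqP; apply: wscale_neq0 => //; rewrite gt_eqF.
apply/iso; first by rewrite subr0.
apply/rowP => i; rewrite !mxE hE// hpart_wscale//.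
have [->|Hi] := eqVneq (hpart w d a i y) 0; first by rewrite mulr0.
by case: noi; exists i.
Qed.

(** The zero set of the coordinates in [A_w] is stable under scaling, and [partial i0 f] vanishes on
    it near 0. The estimate then reads [s^(d - w i0) |H i0 y| <= C s^(d + 1 - w i0)]; divide and let
    [s] tend to 0. *)
Lemma hpart_coordinate_ideal i0 y : i0 \in min_weight_set w ->
  coordinate_ideal (min_weight_set w) (partial i0 f) ->
  sup_norm y <= 1 -> (forall i, i \in min_weight_set w -> y 0 i = 0) ->
  hpart w d a i0 y = 0.
Proof.
move=> i0A [q _ /nbhs_sup_normP[r2 r20 fq]] y1 yA.
(* The division by a power of [s] needs [d.+1 - w i0 = (d - w i0).+1], which truncation would
   spoil. *)
have [dw|wd] := ltnP d (w i0).
  by apply/eqP; apply: contraTT dw => /hpart_neq0_weight; rewrite -leqNgt.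
have [r [B [r01 bB fE _]]] := analytic_partial fs.
have /andP[r_gt0 r_le1] := r01.
have est := partial_hpart_le w_ge1 taylor_coef_weight_lt r01 bB fE.
apply: eq0_normc; apply/eqP; rewrite eq_le normc_ge0 andbT.
apply: (@le0_of_small_le _ _ (B / r ^+ d.+1) (Num.min r r2 / 2)).
  by rewrite divr_gt0// lt_min r_gt0.
move=> s s0 sr s1.
have min0 : 0 < Num.min r r2 by rewrite lt_min r_gt0.
have /andP[sr' sr2] : (s < r) && (s < r2).
  by rewrite -lt_min; move: sr min0; lra.
have := est i0 s y; rewrite ltW//= sr' => /(_ isT y1).
have -> : partial i0 f (wscale w s y) = 0.
  rewrite fq; first by rewrite big1// => i iA; rewrite mxE yA// mulr0 mul0r.
  rewrite subr0; apply: le_lt_trans (wscale_sup_norm (m := 1) _ _ _) _ => //.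
    by rewrite ltW.
  by rewrite expr1; apply: le_lt_trans sr2; rewrite ler_piMr// ltW.
rewrite sub0r normcN hpart_wscale// normcM normc_real ger0_norm; last first.
  by rewrite exprn_ge0// ltW.
by rewrite subSn// [s ^+ _.+1]exprS [leRHS]mulrA [leRHS]mulrC ler_pM2l// exprn_gt0.
Qed.

(** Each nonzero term of the derivative keeps a factor [x_i0], since [k i0 - 1 >= 1]. *)
Lemma hpart_supp_at i0 y : (forall k, supp_at i0 f k -> (2 <= k i0)%N) ->
  y 0 i0 = 0 -> hpart w d a i0 y = 0.
Proof.
move=> supp2 y0; apply: big1 => k _; rewrite /hcoef; case: ifP => _; last first.
  by rewrite mul0r.
rewrite /dcoef /=; have [->|ak] := eqVneq (a k) 0; first by rewrite !mul0r.
have [->|ki] := eqVneq (k i0) 0%N; first by rewrite mulr0 mul0r.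
have k2 : (2 <= k i0)%N by apply: supp2; split => //; exact/eqP.
rewrite /monomial (bigD1 i0)//= y0 ffunE eqxx subn1 expr0n.
by rewrite (_ : ((k i0).-1 == 0)%N = false) ?mul0r ?mulr0//; lia.
Qed.

End principal.

Theorem corollary4p13 (R : realType) (n : nat) (w : 'I_n -> nat)
    (w_ge1 : forall i, (1 <= w i)%N) (w_primitive : primitive_weight w)
    (d : nat) (f : 'rV[R[i]]_n -> R[i])
    (f_holomorphic : holomorphic_germ f) (f_0 : f 0 = 0)
    (f_swh : semi_weighted_homogeneous w d f) :
  let w0 := min_weight w in
  let Aw := min_weight_set w in
  let h := principal_part w f in
  let exponents_agree :=
    lojasiewicz_exponent (gradient h) = lojasiewicz_exponent (gradient f) /\
    lojasiewicz_exponent (gradient f) = ((d%:R - w0%:R) / w0%:R)%:E in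
  ((exists2 i0, i0 \in Aw & coordinate_ideal Aw (partial i0 f)) ->
    exponents_agree) /\
  (forall i0, Aw = [set i0]%SET ->
    (forall k, supp_at i0 f k -> (2 <= k i0)%N) ->
    exponents_agree).
Proof.
move=> w0 Aw h agree; have [_ dE h_iso] := f_swh; subst d.
have [r0 [M fs]] := power_expansion_series (xgetPex (fun=> 0) f_holomorphic).
(* Both alternatives enter only through this vanishing, which concerns [h] alone and so serves for
   [f] and [h] at once. *)
have main i0 : i0 \in Aw -> (forall y, sup_norm y <= 1 ->
    (forall i, i \in Aw -> y 0 i = 0) ->
    hpart w (weighted_order w f) (taylor_coef f) i0 y = 0) -> agree.
  move=> i0A HA.
  have iso := hpart_isolated w_ge1 fs h_iso.
  have H0 := hpart0 w_ge1 fs h_iso.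
  have hL : lojasiewicz_exponent (gradient h) =
      (((weighted_order w f)%:R - w0%:R) / w0%:R)%:E.
    apply: (lojasiewicz_exponent_gradient w_ge1 (principal_part_series w_ge1 fs) _ _ _ i0A);
      rewrite ?hpart_principal_coef//.
    by move=> k kd; rewrite /principal_coef; case: eqP kd => // ->; rewrite ltnn.
  have fL : lojasiewicz_exponent (gradient f) =
      (((weighted_order w f)%:R - w0%:R) / w0%:R)%:E.
    exact: (lojasiewicz_exponent_gradient w_ge1 fs (@taylor_coef_weight_lt _ _ _ _) iso H0 i0A).
  by split; [exact: etrans hL (esym fL)|exact: fL].
split=> [[i0 i0A ideal]|i0 AwE supp2].
  by apply: (main i0 i0A) => y y1 yA; apply: (hpart_coordinate_ideal w_ge1 fs i0A).
apply: (main i0) => [|y _ yA]; first by rewrite AwE inE.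
by apply: hpart_supp_at => //; apply: yA; rewrite AwE inE.
Qed.
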